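(* Suppose $P=(\frac12,0,\nu)$ with $\frac13\le\nu<\frac12$, $0\le\varepsilon\le\frac1{10}$ and $\varrho\ge1$, and let $P_\varepsilon=(\frac12-\varepsilon,\varepsilon,\nu-2\varepsilon)$. Then $$C_{\mathrm{bd}}^-(P_\varepsilon;\varrho)=1+O_\varrho(\varepsilon)\qquad\text{and}\qquad C_{\mathrm{bd}}^+(P_\varepsilon;\varrho)=1+O_\varrho(\varepsilon).$$
   Context: Conventions. $p$, with or without subscripts, denotes a prime; $\tau$ is the number-of-divisors function; $\tau^B(m)=\tau(m)^B$. All sequences $(a_n),(b_n),(w_n)$ are real and supported on integers $x/2<n\le x$. Triples $P=(\gamma,\theta,\nu)$ satisfy $0<\gamma<1$, $0\le\theta<\frac12$, $0<\nu\le1-\theta$. For $B>0$, condition (I) (Type I) is $$\sum_{m\le x^{\gamma}}\tau^B(m)\max_{\mathcal I\text{ interval}}\Big|\sum_{x/2<mn\le x,\ n\in\mathcal I}w_{mn}\Big|\le \frac{x}{(\log x)^B}.$$ Condition (II) (Type II) is: for all complex $\xi_m,\kappa_n$ with $|\xi_m|\le\tau^B(m)$, $|\kappa_n|\le\tau^B(n)$, $$\Big|\sum_{(x/2)^\theta<m\le x^{\theta+\nu},\ x/2<mn\le x}\xi_m\kappa_nw_{mn}\Big|\le\frac{x}{(\log x)^B}.$$ For $\varpi\ge 1$, condition (w) is: $\sum_n|w_n|\tau(n)\le x(\log x)^\varpi$ and $w_n\ge -x^{\nu/10}$ for $x/2<n\le x$. Vectors. For $\mathbf x=(x_1,\dots,x_k)$,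 a subsum is $\sum_{i\in A}x_i$ with $A\subseteq\{1,\dots,k\}$; it is proper if $0<|A|<k$. $\mathcal R(P)$ is the set of all vectors, of arbitrary dimension, with components in $(0,1-\gamma)$, sum of components $1$, and no proper subsum in $[\theta,\theta+\nu]$. A coagulation of $\mathbf x$ is a vector $(\sum_{i\in A_1}x_i,\dots,\sum_{i\in A_h}x_i)$ where $A_1\sqcup\dots\sqcup A_h=\{1,\dots,k\}$ with all $A_j$ nonempty; $\mathcal C(\mathcal R)$ is the set of all coagulations of vectors in $\mathcal R$. Integrals over subsets of a hyperplane $x_1+\dots+x_k=z$ are with respect to the projection (Lebesgue) measure on the first $k-1$ coordinates. Conditions on $(b_n)$: (b.1) $\sum_pb_p\ge x/(\log x)^{\varpi}$. (b.2) For every $2\le k\le1/\nu$, every convex $\mathcal T\subseteq\{\mathbf x\in\mathbb R^k\cap\mathcal C(\mathcal R(P)):\nu\le x_1\le\dots\le x_k\}$ and every $f$ on $\mathcal T$ with $|f|\le1$ and Lipschitz constant $\le1$ ($f$ being taken as $0$ off $\mathcal T$), $$\sum_{n=p_1\cdots p_k,\ p_1\le\dots\le p_k}b_nf\Big(\tfrac{\log p_1}{\log n},\dots,\tfrac{\log p_k}{\log n}\Big)=\Big(\sum_pb_p\Big)\Big(\int_{\mathcal T}\frac{f(\mathbf u)\,d\mathbf u}{u_1\cdots u_k}+E\Big),\quad|E|\le\frac1B.$$ $\Psi(P;B,\varpi,x)$ is the set of pairs $((a_n),(b_n))$ of non-negative sequences supported on $x/2<n\le x$ such that (b.1), (b.2)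 hold and $w_n=a_n-b_n$ satisfies (I), (II), (w). For $\varrho\ge1$, condition (BD) is: $|w_n|\le\tau(n)^\varrho$ for $x/2<n\le x$, and $\sum_pb_p\ge\frac{x}{\varrho\log x}$. $C_{\mathrm{bd}}^-(P;\varrho)$ (resp. $C_{\mathrm{bd}}^+(P;\varrho)$) is the supremum (resp. infimum) of all $C$ such that for any $\varpi>1$ there exists $B>0$ (depending on $P,\varpi,C,\varrho$) so that, whenever $x$ is sufficiently large (in terms of $P,B,C,\varrho$), (BD) holds and $((a_n),(b_n))\in\Psi(P;B,\varpi,x)$, we have $\sum_pa_p\ge C\sum_pb_p$ (resp. $\sum_pa_p\le C\sum_pb_p$); $C_{\mathrm{bd}}^+=\infty$ if no such $C$ exists. *)

(* Defs.v *)
From HB Require Import structures.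
From mathcomp Require Import all_boot all_order all_algebra.
From mathcomp Require Import complex.
From mathcomp Require Import all_classical all_reals all_analysis.
From mathcomp Require Import lra.

Set Implicit Arguments.
Unset Strict Implicit.
Unset Printing Implicit Defensive.

Import Order.TTheory GRing.Theory Num.Theory.
Import numFieldNormedType.Exports.

Local Open Scope classical_set_scope.
Local Open Scope ring_scope.

Section lebesgue_cons.
Variables (R : realType) (n : nat).
Variable mu : {sigma_finite_measure set (n.-tuple (measurableTypeR R)) -> \bar R}.
Let T := measurableTypeR R.

Definition tuple_cons (p : T * n.-tuple T) : n.+1.-tuple T :=
  [tuple of p.1 :: p.2].

Lemma measurable_tuple_cons : measurable_fun setT tuple_cons.
Proof. exact: measurable_cons. Qed.

Definition lebesgue_cons : set (n.+1.-tuple T) -> \bar R :=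
  pushforward (lebesgue_measure \x mu)%E tuple_cons.

Let lebesgue_cons0 : lebesgue_cons set0 = 0%E.
Proof. by rewrite /lebesgue_cons /pushforward preimage_set0 measure0. Qed.

Let lebesgue_cons_ge0 A : (0 <= lebesgue_cons A)%E.
Proof. exact: (measure_ge0 (lebesgue_measure \x mu)%E). Qed.

Let lebesgue_cons_sigma_additive : semi_sigma_additive lebesgue_cons.
Proof.
move=> F mF tF mUF; rewrite /lebesgue_cons /pushforward preimage_bigcup.
have mp A : measurable A -> measurable (tuple_cons @^-1` A).
  by move=> mA; rewrite -[X in measurable X]setTI; exact: measurable_tuple_cons.
apply: measure_semi_sigma_additive.
- by move=> i; exact: mp.
- apply/trivIsetP => i j _ _ ij; rewrite -preimage_setI.
  by move/trivIsetP : tF => /(_ _ _ _ _ ij) ->//; rewrite preimage_set0.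
- by rewrite -preimage_bigcup; exact: mp.
Qed.

HB.instance Definition _ := isMeasure.Build _ _ _ lebesgue_cons
  lebesgue_cons0 lebesgue_cons_ge0 lebesgue_cons_sigma_additive.

Let lebesgue_cons_sigma_finite : sigma_finite setT lebesgue_cons.
Proof.
pose uncons (v : n.+1.-tuple T) : T * n.-tuple T := (thead v, [tuple of behead v]).
have mb : measurable_fun setT uncons.
  by apply: measurable_fun_pair; [exact: measurable_tnth|exact: measurable_behead].
have consK p : uncons (tuple_cons p) = p.
  by case: p => t v; congr pair; apply/val_inj.
have /sigma_finiteP[F [FT ndF Foo]] := sigma_finiteT (@lebesgue_measure R).
have /sigma_finiteP[G [GT ndG Goo]] := sigma_finiteT mu.
exists (fun i => uncons @^-1` (F i `*` G i)).
  apply/seteqP; split => // v _.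
  have [i _ Fi] : (\bigcup_i F i) (uncons v).1 by rewrite -FT.
  have [j _ Gj] : (\bigcup_i G i) (uncons v).2 by rewrite -GT.
  exists (maxn i j) => //; split.
    by move: Fi; exact/subsetPset/ndF/leq_maxl.
  by move: Gj; exact/subsetPset/ndG/leq_maxr.
move=> i; have [mF Fi] := Foo i; have [mG Gi] := Goo i; split.
  by rewrite -[X in measurable X]setTI; apply: mb => //; exact: measurableX.
rewrite /lebesgue_cons /pushforward [X in (_ X < _)%E](_ : _ = F i `*` G i).
  by rewrite product_measure1E// lte_mul_pinfty// ge0_fin_numE.
by apply/funext => p; rewrite /preimage /mkset consK.
Qed.

HB.instance Definition _ := Measure_isSigmaFinite.Build _ _ _ lebesgue_cons
  lebesgue_cons_sigma_finite.

End lebesgue_cons.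

(* Lebesgue measure on R^n, realized on n-tuples: a unit mass on the one-point
   space R^0, then iterated products. *)
Fixpoint lebesgue_tuple (R : realType) (n : nat) :
    {sigma_finite_measure set (n.-tuple (measurableTypeR R)) -> \bar R} :=
  match n with
  | 0 => dirac ([tuple] : 0.-tuple (measurableTypeR R))
  | n'.+1 => lebesgue_cons (lebesgue_tuple R n')
  end.

Section prime_producing.
Variable R : realType.
Implicit Types (B varpi rho x : R) (a b w : nat -> R).

Record triple := Triple { gamma : R; theta : R; nu : R }.
Implicit Types P : triple.

Definition admissible_triple P : Prop :=
  [/\ 0 < gamma P < 1, 0 <= theta P < 2^-1 & 0 < nu P <= 1 - theta P].

Definition tau (m : nat) : nat := size (divisors m).

Definition tau_pow B (m : nat) : R := (tau m)%:R `^ B.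

Definition dyadic x (n : nat) : bool := x / 2 < n%:R <= x.

Definition supported x a : Prop := forall n, ~~ dyadic x n -> a n = 0.

(* Meant for sequences supported on x/2 < n <= x, so that the truncation of the
   index at x loses nothing; likewise in the sums below. *)
Definition prime_sum x a : R :=
  \sum_(1 <= p < (Num.truncn x).+1 | prime p) a p.

(* [interval R] ranges over all intervals of the line, and the inner sum takes
   finitely many values as I varies, so this supremum is a maximum. *)
Definition max_interval_sum x w (m : nat) : R :=
  sup [set `|\sum_(1 <= n < (Num.truncn x).+1
                    | dyadic x (m * n) && (n%:R \in I)) w (m * n)%N|
      | I in [set: interval R]].

Definition type_I P B x w : Prop :=
  \sum_(1 <= m < (Num.truncn (x `^ gamma P)).+1)
      tau_pow B m * max_interval_sum x w m
    <= x / ln x `^ B.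

Definition type_II P B x w : Prop :=
  forall xi kappa : nat -> R[i],
    (forall m, (0 < m)%N -> `|xi m| <= (tau_pow B m)%:C%C) ->
    (forall n, (0 < n)%N -> `|kappa n| <= (tau_pow B n)%:C%C) ->
    `|\sum_(1 <= m < (Num.truncn x).+1
              | (x / 2) `^ theta P < m%:R <= x `^ (theta P + nu P))
        \sum_(1 <= n < (Num.truncn x).+1 | dyadic x (m * n))
          xi m * kappa n * (w (m * n)%N)%:C%C|
      <= (x / ln x `^ B)%:C%C.

Definition cond_w P varpi x w : Prop :=
  \sum_(1 <= n < (Num.truncn x).+1) `|w n| * (tau n)%:R <= x * ln x `^ varpi /\
  (forall n, dyadic x n -> - (x `^ (nu P / 10)) <= w n).

Definition vectors_R P (k : nat) : set 'rV[R]_k :=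
  [set u | [/\ forall i, 0 < u 0 i < 1 - gamma P,
               \sum_i u 0 i = 1
             & forall A : {set 'I_k}, (0 < #|A| < k)%N ->
                 ~~ (theta P <= \sum_(i in A) u 0 i <= theta P + nu P)]].

Definition coagulation (k h : nat) (u : 'rV[R]_k) (v : 'rV[R]_h) : Prop :=
  exists A : 'I_h -> {set 'I_k},
    [/\ forall j, A j != finset.set0,
        forall i, exists! j, i \in A j
      & v = \row_j \sum_(i in A j) u 0 i].

Definition coagulations_R P (h : nat) : set 'rV[R]_h :=
  [set v | exists k (u : 'rV[R]_k), vectors_R P u /\ coagulation u v].

(* The library norm on matrices is the sup norm. *)
Definition euclidean_dist (k : nat) (u v : 'rV[R]_k) : R :=
  Num.sqrt (\sum_i (u 0 i - v 0 i) ^+ 2).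

(* The point of the hyperplane u_1 + ... + u_k = 1 lying over (u_1,...,u_(k-1));
   at the last index [nth] returns its default value. *)
Definition simplex_point (k : nat) (u : k.-1.-tuple R) : 'rV[R]_k :=
  \row_(i < k) nth (1 - \sum_(t <- u) t) u i.

(* A convex set of tuples need not be Borel, but it is Lebesgue measurable; the
   library integral is a supremum over Borel simple functions and so still
   agrees with the usual integral. *)
Definition hyperplane_integral (k : nat) (T : set 'rV[R]_k)
    (g : 'rV[R]_k -> R) : R :=
  \int[lebesgue_tuple R k.-1]_(u in @simplex_point k @^-1` T)
    g (simplex_point u).

(* Sum over n = p_1 ... p_k with p_1 <= ... <= p_k primes. *)
Definition prime_tuple_sum x b (k : nat) (f : 'rV[R]_k -> R) : R :=
  \sum_(p : {ffun 'I_k -> 'I_(Num.truncn x).+1} |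
          [forall i, prime (p i)] &&
          [forall i : 'I_k, forall j : 'I_k, (i <= j)%N ==> (p i <= p j)%N])
    let n := (\prod_(i < k) p i)%N in
    b n * f (\row_i (ln (p i)%:R / ln n%:R)).

Definition cond_b1 varpi x b : Prop := x / ln x `^ varpi <= prime_sum x b.

Definition cond_b2 P B x b : Prop :=
  forall (k : nat) (T : set 'rV[R]_k) (f : 'rV[R]_k -> R),
    (2 <= k)%N -> k%:R <= (nu P)^-1 ->
    convex_set T ->
    T `<=` [set u | [/\ coagulations_R P u, forall i, nu P <= u 0 i
                      & forall i j : 'I_k, (i <= j)%N -> u 0 i <= u 0 j]] ->
    (forall u, T u -> `|f u| <= 1) ->
    (forall u v, T u -> T v -> `|f u - f v| <= euclidean_dist u v) ->
    exists2 E : R, `|E| <= B^-1 &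
      prime_tuple_sum x b (patch (fun=> 0) T f) =
      prime_sum x b *
        (hyperplane_integral T (fun u => f u / \prod_i u 0 i) + E).

Definition Psi P B varpi x : set ((nat -> R) * (nat -> R)) :=
  [set ab | let: (a, b) := ab in
    let w := fun n => a n - b n in
    [/\ (forall n, 0 <= a n) /\ (forall n, 0 <= b n),
        supported x a /\ supported x b,
        cond_b1 varpi x b /\ cond_b2 P B x b
      & [/\ type_I P B x w, type_II P B x w & cond_w P varpi x w]]].

Definition cond_BD rho x a b : Prop :=
  (forall n, dyadic x n -> `|a n - b n| <= tau_pow rho n) /\
  x / (rho * ln x) <= prime_sum x b.

Definition lower_constants P rho : set R :=
  [set C | forall varpi, 1 < varpi -> exists2 B, 0 < B &
    \forall x \near +oo, forall a b,
      cond_BD rho x a b -> Psi P B varpi x (a, b) ->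
      C * prime_sum x b <= prime_sum x a].

Definition upper_constants P rho : set R :=
  [set C | forall varpi, 1 < varpi -> exists2 B, 0 < B &
    \forall x \near +oo, forall a b,
      cond_BD rho x a b -> Psi P B varpi x (a, b) ->
      prime_sum x a <= C * prime_sum x b].

Definition C_bd_minus P rho : \bar R :=
  ereal_sup [set C%:E | C in lower_constants P rho].

(* The infimum of the empty set is +oo. *)
Definition C_bd_plus P rho : \bar R :=
  ereal_inf [set C%:E | C in upper_constants P rho].

Lemma perturbed_triple_admissible (n e : R) :
  3^-1 <= n < 2^-1 -> 0 <= e <= 10^-1 ->
  admissible_triple (Triple (2^-1 - e) e (n - 2 * e)).
Proof. by move=> nP eP; split => /=; lra. Qed.

End prime_producing.

(* Main.v *)
Require Import Defs.
From mathcomp Require Import all_boot all_order all_algebra.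
From mathcomp Require Import complex.
From mathcomp Require Import all_classical all_reals all_analysis.
From mathcomp Require Import measurable_realfun.
From mathcomp Require Import zify ring lra.

(* The weights w = a - b are summed against the indicator of the primes. Let eta
   be slightly larger than eps, z1 = x^(nu-eta), z2 = x^(1/2-2 eta), and call k rough
   when all its primes are at least z1. On x/2 < n <= x the indicator of the primes
   equals [n rough] - #{p | n : z1 <= p <= z2, n/p rough} except when n is a product
   of two primes of size x^(1/2+O(eta)) or of three primes of size x^(1/3+O(eta));
   by Chebyshev there are O(eta x / log x) such n, each with |w_n| = O_rho(1).
   Roughness is expanded by Legendre's formula; divisors d <= (x/2)^eta give Type I
   sums; for the others the first partial product exceeding (x/2)^eta, primes being
   taken in decreasing order, lies in the Type II range. The remaining condition
   that the least prime of that product is at most that of the cofactor is separated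
   by random signs, at the cost of a factor log x. For large eps the trivial bound
   suffices.

   For C^- <= 1 <= C^+ one needs pairs with a = b satisfying (b.2). Cut the
   simplex into a fine grid and, by Bertrand's postulate, put in each inner cell the
   point of one product p_1...p_k in (x/2,x], with mass the volume of the cell over
   u_1...u_k. Then (b.2) compares an integral with a Riemann sum, and a convex set
   has few boundary cells: a point outside it has an open orthant missing it. *)

Set Implicit Arguments.
Unset Strict Implicit.
Unset Printing Implicit Defensive.

(** * Bertrand's postulate for large integers *)

(** The exponents are forced by the two ranges. A prime p <= z2 times a divisor at most (x/2)^eta
    must stay below the Type I level x^(1/2-eps), so z2 has to stop short of x^(1/2); this is what
    leaves exceptional products of two primes. A divisor leaving (x/2)^eta may be a single prime
    just below z1, and the Type II range ends at x^(nu-eps), whence z1 = x^(nu-eta). Since nu >=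
    1/3, z1^4 exceeds x and a rough n has at most three prime factors. The choice eta > eps matters
    at eps = 0: the bilinear error O(x / log^2 x) must be absorbed into eta x / log x, which needs
    eta > 0. The resulting bound is linear in eta, and eta - eps may be taken arbitrarily small, so
    a pure multiple of eps survives in the constants. Pairs with a = b are needed because a constant
    is admissible vacuously when no pair exists. They are easy to produce sparsely: the pointwise
    size conditions concern w = a - b, so b itself may consist of a few large point masses. *)

Lemma prod_primes_dvd (s : seq nat) (n : nat) :
  uniq s -> (forall p, p \in s -> prime p /\ p %| n) -> \prod_(p <- s) p %| n.
Proof.
elim: s => [|p s IH] /=; first by rewrite big_nil dvd1n.
case/andP=> ps us H; rewrite big_cons Gauss_dvd.
  rewrite (proj2 (H p _)) ?mem_head // IH // => q qs.
  by apply: H; rewrite inE qs orbT.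
have [pp _] := H p (mem_head _ _).
rewrite prime_coprime // Euclid_dvd_prod //; apply/negP; rewrite big_has => /hasP[q qs].
have [pq _] : prime q /\ q %| n by apply: H; rewrite inE qs orbT.
by rewrite dvdn_prime2 // => /eqP pq'; rewrite pq' qs in ps.
Qed.

Lemma prime_dvd_fact (p n : nat) : prime p -> (p %| n`!) = (p <= n).
Proof.
move=> pp; apply/idP/idP; last by move=> pn; apply: dvdn_fact; rewrite prime_gt0.
elim: n => [|n IH]; first by rewrite fact0 dvdn1 => /eqP p1; rewrite p1 in pp.
rewrite factS Euclid_dvdM // => /orP[/dvdn_leq->//|/IH]; lia.
Qed.

Lemma bin_odd_le (m : nat) : 'C(2 * m + 1, m) <= 4 ^ m.
Proof.
have E := expnDn 1 1 (2 * m + 1).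
have : 2 * 'C(2 * m + 1, m) <= (1 + 1) ^ (2 * m + 1).
  rewrite E (bigD1 (inord m)) //= (bigD1 (inord m.+1)) /=; last first.
    by rewrite -val_eqE /= !inordK; lia.
  rewrite !inordK; try lia.
  rewrite !exp1n !muln1 -(@bin_sub _ m.+1); last lia.
  have -> : 2 * m + 1 - m.+1 = m by lia.
  lia.
rewrite expnD expnM; have -> : (1 + 1) ^ 2 = 4 by []. lia.
Qed.

(** Erdos's induction: for odd n = 2m+1 the primes in (m+1, n] all divide a binomial coefficient
    that is at most 4^m; an even n > 2 is not prime and reduces to n - 1. *)
Lemma primorial_le (n : nat) :
  \prod_(p <- [seq p <- iota 0 n.+1 | prime p]) p <= 4 ^ n.
Proof.
have [k] := ubnP n; elim: k n => // k IH n nk.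
have [n2|n2] := leqP n 2.
  by move: n n2 {nk} => [|[|[|]]] //= _; rewrite ?big_cons big_nil.
have [on|en] := boolP (odd n); last first.
  have -> : [seq p <- iota 0 n.+1 | prime p] = [seq p <- iota 0 n | prime p].
    rewrite -addn1 iotaD filter_cat /= add0n; case: ifP => [pn|]; last by rewrite cats0.
    by have [n2'|] := even_prime pn; [lia|rewrite (negPf en)].
  have E : n = n.-1.+1 by lia.
  rewrite [X in iota 0 X]E; apply: (leq_trans (IH _ _)); first lia.
  by rewrite leq_exp2l; lia.
pose m := n./2; have nE : n = 2 * m + 1 by move: (odd_double_half n); rewrite on; lia.
have -> : iota 0 n.+1 = iota 0 m.+2 ++ iota m.+2 m.
  by rewrite -{2}[m.+2]add0n -iotaD; congr iota; lia.
rewrite filter_cat big_cat /=.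
have -> : 4 ^ n = 4 ^ m.+1 * 4 ^ m by rewrite -expnD; congr expn; lia.
apply: leq_mul; first by apply: IH; lia.
apply: leq_trans (bin_odd_le m); apply: dvdn_leq; first by rewrite bin_gt0; lia.
apply: prod_primes_dvd; first by rewrite filter_uniq // iota_uniq.
move=> p; rewrite mem_filter mem_iota => /and3P[pp p1 p2]; split=> //.
have := @bin_fact (2 * m + 1) m ltac:(lia).
move/(congr1 (dvdn p)); rewrite !Euclid_dvdM // !prime_dvd_fact //.
have -> : p <= 2 * m + 1 by lia.
have -> : (p <= m) = false by lia.
have -> : (p <= 2 * m + 1 - m) = false by lia.
by rewrite !orbF.
Qed.

Lemma prod_primes_le (s : seq nat) (n : nat) :
  uniq s -> (forall p, p \in s -> prime p && (p <= n)) -> \prod_(p <- s) p <= 4 ^ n.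
Proof.
move=> us sP; apply: leq_trans (primorial_le n); apply: dvdn_leq.
  rewrite big_seq; apply: prodn_cond_gt0 => p; rewrite mem_filter => /andP[pp _].
  exact: prime_gt0.
apply: prod_primes_dvd => // p ps; have /andP[pp pn] := sP p ps; split=> //.
have pin : p \in [seq q <- iota 0 n.+1 | prime q] by rewrite mem_filter pp mem_iota /= add0n ltnS.
by rewrite (big_rem p pin) dvdn_mulr.
Qed.

Lemma central_bin_ge (n : nat) : 0 < n -> 4 ^ n <= 2 * n * 'C(2 * n, n).
Proof.
elim: n => // -[_ _|n IH _] //.
move: {IH}(IH isT); set m := n.+1 => IH.
have := mul_bin_diag (2 * m.+1) m; have := mul_bin_down (2 * m + 1) m.
have -> : (2 * m + 1).-1 = 2 * m by lia.
have -> : (2 * m.+1).-1 = 2 * m + 1 by lia.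
have -> : 2 * m + 1 - m = m.+1 by lia.
move: ('C(2 * m, m)) ('C(2 * m + 1, m)) ('C(2 * m.+1, m.+1)) IH => a b c IH H1 H2.
rewrite expnS; nia.
Qed.

(** Legendre's formula for (2n)! and n!, kept additive because subtraction of naturals truncates.
    Both sums run to 2n, where the extra terms vanish. *)
Lemma logn_central_bin (p n : nat) : prime p -> 0 < n ->
  logn p 'C(2 * n, n) + 2 * \sum_(1 <= k < (2 * n).+1) n %/ p ^ k =
  \sum_(1 <= k < (2 * n).+1) (2 * n) %/ p ^ k.
Proof.
move=> pp n0; rewrite -[RHS](logn_fact _ pp).
rewrite -(@bin_fact (2 * n) n ltac:(lia)) !lognM ?muln_gt0 ?fact_gt0 ?bin_gt0; try lia.
have -> : 2 * n - n = n by lia.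
rewrite logn_fact //.
have -> : \sum_(1 <= k < (2 * n).+1) n %/ p ^ k = \sum_(1 <= k < n.+1) n %/ p ^ k.
  rewrite (@big_cat_nat _ _ _ n.+1) //=; try lia.
  rewrite [X in _ + X = _]big_nat [X in _ + X = _]big1 ?addn0 //.
  move=> i /andP[ni _]; apply/divn_small/(leq_trans ni)/ltnW/ltn_expl/prime_gt1/pp.
lia.
Qed.

(** Each difference floor(2n/p^k) - 2 floor(n/p^k) is 0 or 1, and it is 0 for k > K. *)
Lemma logn_central_bin_le (p n K : nat) : prime p -> 0 < n -> 2 * n < p ^ K.+1 ->
  logn p 'C(2 * n, n) <= K.
Proof.
move=> pp n0 nK; have := logn_central_bin pp n0.
have : \sum_(1 <= k < (2 * n).+1) (2 * n) %/ p ^ k <=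
       2 * (\sum_(1 <= k < (2 * n).+1) n %/ p ^ k) + \sum_(1 <= k < (2 * n).+1) (k <= K).
  rewrite big_distrr -big_split /=; apply: leq_sum => k _.
  have [kK|Kk] := leqP k K; last first.
    rewrite divn_small ?leq0n // (leq_trans nK) // leq_exp2l // prime_gt1 //.
  have pk : 0 < p ^ k by rewrite expn_gt0 prime_gt0.
  rewrite -ltnS ltn_divLR //; have := divn_eq n (p ^ k); have := ltn_pmod n pk; nia.
have : \sum_(1 <= k < (2 * n).+1) (k <= K) <= K.
  have [|] := leqP (2 * n).+1 K.+1 => h.
    apply: (@leq_trans (\sum_(1 <= k < (2 * n).+1) 1)); first by apply: leq_sum => k _; exact: leq_b1.
    rewrite sum_nat_const_nat; lia.
  rewrite (@big_cat_nat _ _ _ K.+1) //=; last lia.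
  rewrite [X in _ + X]big_nat [X in _ + X]big1; last by move=> k; lia.
  rewrite addn0; apply: (@leq_trans (\sum_(1 <= k < K.+1) 1)).
    by apply: leq_sum => k _; exact: leq_b1.
  rewrite sum_nat_const_nat; lia.
lia.
Qed.

Lemma exists_sqrtn (n : nat) : exists s, s ^ 2 <= n < s.+1 ^ 2.
Proof.
elim: n => [|n [s /andP[h1 h2]]]; first by exists 0.
have [h|h] := leqP (s.+1 ^ 2) n.+1; last by exists s; lia.
by exists s.+1; rewrite h /=; lia.
Qed.

(** Erdos's argument. Without a prime in (n, 2n], all primes dividing the central binomial
    coefficient are at most 2n/3. Those up to s, the integer square root of 2n, contribute at most
    2n each; the others occur to the first power and multiply to at most 4^(2n/3). This is too
    little for 4^n / (2n). *)
Lemma bertrand_large (n : nat) : 64 ^ 2 <= 2 * n -> exists2 p, prime p & n < p <= 2 * n.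
Proof.
move=> n_large; have n0 : 0 < n by move: n_large; case: n.
have [s /andP[s1 s2]] := exists_sqrtn (2 * n).
have {n_large} s64 : 64 < s.+1.
  by rewrite -(@ltn_exp2r _ _ 2) //; exact: leq_ltn_trans n_large s2.
pose k := trunc_log 2 s.+1.
have k6 : 6 <= k by rewrite -[6](@trunc_expnK 2) //; apply/leq_trunc_log/ltnW.
have s3 : 3 <= s by move: s64; clear; case: s => [|[|[|]]].
clear s64.
have [/hasP[p]|/hasPn noP] := boolP (has prime (iota n.+1 n)).
  by rewrite mem_iota => pn pp; exists p => //; lia.
exfalso; pose c := 'C(2 * n, n); have c0 : 0 < c by rewrite bin_gt0; lia.
have log0 p : prime p -> 2 * n < 3 * p -> 3 <= p -> logn p c = 0.
  move=> pp p3 p3'; have [h|h] := leqP p n; last first.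
    have [h'|h'] := leqP p (2 * n).
      by move: (noP p); rewrite pp mem_iota => /(_ ltac:(lia)).
    apply/eqP; rewrite -leqn0; apply: logn_central_bin_le => //; lia.
  have := logn_central_bin pp n0; rewrite -/c.
  have E j : 1 < j -> 2 * n < p ^ j.
    move=> j1; apply: (@leq_trans (p ^ 2)); last by rewrite leq_exp2l //; lia.
    nia.
  rewrite !(@big_ltn _ _ _ 1 (2 * n).+1); try lia.
  have S0 m : m <= 2 * n -> \sum_(2 <= j < (2 * n).+1) m %/ p ^ j = 0.
    move=> mn; rewrite big_nat big1 // => j /andP[j1 _].
    by apply: divn_small; have := E j j1; lia.
  rewrite !S0; try lia.
  rewrite !expn1; have -> : n %/ p = 1.
    by apply/eqP; rewrite eqn_leq leq_divRL; [rewrite -ltnS ltn_divLR; lia|lia].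
  have -> : 2 * n %/ p = 2.
    by apply/eqP; rewrite eqn_leq leq_divRL; [rewrite -ltnS ltn_divLR; lia|lia].
  lia.
have cle : c <= (2 * n) ^ s * 4 ^ (2 * n %/ 3).
  rewrite [c](prod_prime_decomp c0) prime_decompE big_map /=.
  rewrite (bigID (fun p => p <= s)) /=; apply: leq_mul.
    rewrite big_seq_cond; apply: (@leq_trans (\prod_(p <- primes c | p <= s) (2 * n))).
      rewrite [X in _ <= X]big_seq_cond; apply: leq_prod => p /andP[].
      rewrite mem_primes => /and3P[pp _ _] _.
      have p1 := prime_gt1 pp.
      have := @trunc_logP p (2 * n) p1 ltac:(lia); apply: leq_trans.
      rewrite leq_exp2l //; apply: logn_central_bin_le => //; exact: trunc_log_ltn.
    rewrite big_const_seq iter_muln muln1 leq_exp2l; last lia.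
    rewrite -size_filter -[X in _ <= X](size_iota 1 s); apply: uniq_leq_size.
      by rewrite filter_uniq // primes_uniq.
    move=> p; rewrite mem_filter mem_iota mem_primes => /and3P[ps pp _].
    by have := prime_gt0 pp; lia.
  rewrite -big_filter; set r := seq.filter _ _.
  have rP p : p \in r -> [/\ prime p, s < p & p %| c].
    by rewrite mem_filter mem_primes => /and4P[]; split=> //; lia.
  have l1 p : p \in r -> logn p c <= 1.
    move=> /rP[pp sp _]; apply: logn_central_bin_le => //.
    by apply: (leq_trans s2); rewrite leq_exp2r.
  apply: (@leq_trans (\prod_(p <- r) p)).
    rewrite big_seq [X in _ <= X]big_seq; apply: leq_prod => p pr.
    rewrite -[X in _ <= X]expn1 leq_exp2l ?l1 // prime_gt1 //.
    by have [] := rP _ pr.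
  apply: prod_primes_le; first by rewrite filter_uniq // primes_uniq.
  move=> p pr; have [pp sp pc] := rP _ pr; rewrite pp /=.
  rewrite leqNgt; apply/negP; rewrite ltn_divLR // => h.
  have : 0 < logn p c by rewrite logn_gt0 mem_primes pp c0.
  rewrite log0 //; [lia|nia].
have c4 := central_bin_ge n0; rewrite -/c in c4.
have /andP[k1 k2] := @trunc_log_bounds 2 s.+1 isT isT; rewrite -/k in k1 k2.
(* From 2n < (s+1)^2 and s+1 < 2^(k+1), the factor (2n)^(s+1) is at most 2^(2(k+1)(s+1)). *)
have key : 4 ^ n <= 2 ^ (2 * (k.+1 * s.+1)) * 4 ^ (2 * n %/ 3).
  apply: (leq_trans c4); apply: (leq_trans (leq_mul (leqnn _) cle)).
  rewrite mulnA -expnS leq_mul2r; apply/orP; right.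
  rewrite mulnA expnM leq_exp2r // [2 * k.+1]mulnC expnM.
  by apply: (leq_trans (ltnW s2)); rewrite leq_exp2r // ltnW.
move: key; rewrite (_ : 4 = 2 ^ 2) // -!expnM -expnD leq_exp2l // => key.
(* The threshold [64 ^ 2] gives k >= 6, where 2^k overtakes 6k+8. Then 6(k+1)+2 <= s, so 2n <=
   6(k+1)(s+1) <= (s-2)(s+1) < s^2, against s^2 <= 2n. *)
have k3 : 6 * k + 8 < 2 ^ k.
  have [j ->] : exists j, k = 6 + j by exists (k - 6); lia.
  elim: j => [//|j IH]; rewrite addnS expnS.
  by move: (2 ^ (6 + j)) IH => N; lia.
clear noP log0 cle c4 k2.
have h1 : 3 * (2 * n %/ 3) <= 2 * n by have := leq_trunc_div (2 * n) 3; lia.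
have h2 : n <= 3 * (k.+1 * s.+1) by lia.
have h3 : 6 * k.+1 + 2 <= s by lia.
nia.
Qed.

Import Order.TTheory GRing.Theory Num.Theory.
Import numFieldNormedType.Exports.
Local Open Scope ring_scope.

(** * Chebyshev bounds *)

Section chebyshev.
Variable R : realType.
Implicit Types (x y z : R) (s : seq nat).

Lemma ln2_le1 : ln 2 <= 1 :> R.
Proof. by have := @le_ln1Dx R 1; rewrite -(natrD _ 1 1); apply; lra. Qed.

Lemma ln4_le2 : ln 4 <= 2 :> R.
Proof.
have -> : 4 = 2 * 2 :> R by rewrite -natrM.
rewrite lnM ?posrE //; have := ln2_le1; lra.
Qed.

Lemma ln_natr_ge0 (n : nat) : 0 <= ln n%:R :> R.
Proof.
by case: n => [|n]; [rewrite ln0|apply: ln_ge0; rewrite ler1n].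
Qed.

Lemma ln_prod_nat s : all (fun p => 0 < p)%N s ->
  ln (\prod_(p <- s) p)%N%:R = \sum_(p <- s) ln p%:R :> R.
Proof.
elim: s => [_|p s IH /= /andP[p0 s0]]; first by rewrite !big_nil ln1.
rewrite !big_cons natrM lnM ?posrE ?ltr0n // ?IH //.
by rewrite big_seq; apply: prodn_cond_gt0 => i /(allP s0).
Qed.

Lemma sum_ln_primes_le y s : 0 <= y -> uniq s ->
  (forall p, p \in s -> prime p /\ p%:R <= y) -> \sum_(p <- s) ln p%:R <= 2 * y.
Proof.
move=> y0 us sP; have /andP[ty _] := truncn_itv y0.
have s0 : all (fun p => 0 < p)%N s.
  by apply/allP => p /sP[/prime_gt0].
rewrite -ln_prod_nat //; apply: (@le_trans _ _ ((Num.trunc y)%:R * ln 4)).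
  rewrite mulr_natl -lnXn // -natrX ler_ln ?posrE ?ltr0n ?expn_gt0 //; last first.
    by rewrite big_seq; apply: prodn_cond_gt0 => i /(allP s0).
  rewrite ler_nat; apply: prod_primes_le => // p /sP[-> py] /=.
  by rewrite truncn_ge_nat.
rewrite mulrC; apply: ler_pM => //; [exact: (ln_natr_ge0 4)|exact: ln4_le2].
Qed.

Lemma size_primes_le y z s : 1 < z -> 0 <= y -> uniq s ->
  (forall p, p \in s -> [/\ prime p, z <= p%:R & p%:R <= y]) ->
  (size s)%:R <= 2 * y / ln z.
Proof.
move=> z1 y0 us sP; have lz : 0 < ln z by rewrite ln_gt0.
rewrite ler_pdivlMr //.
apply: (@le_trans _ _ (\sum_(p <- s) ln p%:R)); last first.
  by apply: sum_ln_primes_le => // p /sP[].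
have -> : (size s)%:R * ln z = \sum_(p <- s) ln z.
  by rewrite big_const_seq count_predT iter_addr_0 mulr_natl.
rewrite big_seq [leRHS]big_seq; apply: ler_sum => p /sP[pp zp _].
by rewrite ler_ln ?posrE ?ltr0n ?prime_gt0 // (lt_trans ltr01).
Qed.

(* Dyadic decomposition: each range [2^i z, 2^(i+1) z) contributes at most 4. *)
Lemma sum_ln_primes_div_le z (r : nat) s : 0 < z -> uniq s ->
  (forall p, p \in s -> [/\ prime p, z <= p%:R & p%:R < 2 ^+ r * z]) ->
  \sum_(p <- s) ln p%:R / p%:R <= 4 * r%:R :> R.
Proof.
move=> z0; elim: r s => [|r IH] s us sP.
  rewrite mulr0 big_seq big1 // => p /sP[_ zp]; rewrite expr0 mul1r ltNge zp //.
set Y := 2 ^+ r * z; have Y0 : 0 < Y by rewrite mulr_gt0 // exprn_gt0.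
rewrite (bigID (fun p => p%:R < Y)) /= -[r.+1%:R]natr1 mulrDr mulr1; apply: lerD.
  rewrite -big_filter; apply: IH; first by rewrite filter_uniq.
  by move=> p; rewrite mem_filter => /andP[pY /sP[]].
rewrite -big_filter; set t := seq.filter _ _.
have tP p : p \in t -> [/\ prime p, Y <= p%:R & p%:R <= 2 * Y].
  rewrite mem_filter -leNgt => /andP[pY /sP[pp _]].
  by rewrite exprS -mulrA -/Y => /ltW.
apply: (@le_trans _ _ (\sum_(p <- t) ln p%:R / Y)).
  rewrite big_seq [leRHS]big_seq; apply: ler_sum => p /tP[pp Yp _].
  by apply: ler_wpM2l; [exact: ln_natr_ge0|rewrite lef_pV2 ?posrE // (lt_le_trans Y0)].
rewrite -mulr_suml ler_pdivrMr //.
apply: (le_trans (@sum_ln_primes_le (2 * Y) _ _ _ _)).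
- by rewrite mulr_ge0 // ltW.
- by rewrite filter_uniq.
- by move=> p /tP[].
- by rewrite mulrA -natrM.
Qed.

(** Since ln 2 >= 1/2, some r <= 2 Lam + 1 dyadic ranges cover a factor [expR Lam], and each is
    worth at most 4 after weighting by ln p >= ln z. The ratio of Lam to ln z is the saving that
    makes the exceptional integers rare. *)
Lemma sum_inv_primes_le z (Lam : R) s : 1 < z -> 0 <= Lam -> uniq s ->
  (forall p, p \in s -> [/\ prime p, z <= p%:R & p%:R <= z * expR Lam]) ->
  \sum_(p <- s) p%:R^-1 <= (8 * Lam + 4) / ln z.
Proof.
move=> z1 Lam0 us sP; have lz : 0 < ln z by rewrite ln_gt0.
have z0 : 0 < z by rewrite (lt_trans ltr01).
pose r := (Num.trunc (2 * Lam)).+1.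
have L2 : 0 <= 2 * Lam by rewrite mulr_ge0.
have rle : r%:R <= 2 * Lam + 1.
  by rewrite /r -[X in X <= _]natr1 lerD2r; have /andP[] := truncn_itv L2.
have rgt : expR Lam < 2 ^+ r.
  have : 2 * Lam < r%:R by have /andP[] := truncn_itv L2.
  move=> h; apply: (@lt_le_trans _ _ (expR (2^-1 * r%:R))).
    by rewrite ltr_expR; lra.
  rewrite mulrC expRM_natl; apply: lerXn2r; rewrite ?nnegrE ?expR_ge0 //.
  rewrite -[leRHS]lnK ?posrE // ler_expR.
  have := @le_ln1Dx R (- 2^-1).
  have -> : 1 + - 2^-1 = 2^-1 :> R by lra.
  rewrite lnV ?posrE // => /(_ ltac:(lra)); lra.
rewrite ler_pdivlMr // mulr_suml.
apply: (@le_trans _ _ (\sum_(p <- s) ln p%:R / p%:R)).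
  rewrite big_seq [leRHS]big_seq; apply: ler_sum => p /sP[pp zp _].
  rewrite mulrC ler_wpM2r ?invr_ge0 // ler_ln ?posrE ?ltr0n ?prime_gt0 //.
apply: (le_trans (@sum_ln_primes_div_le z r s z0 us _)); last lra.
move=> p /sP[pp zp pe]; split=> //; apply: (le_lt_trans pe).
by rewrite mulrC ltr_pM2r.
Qed.

(** For fixed p, Chebyshev's bound counts the q <= x/p. The prime p itself lies in [z, x/z], whose
    logarithmic length is at most Lam, so the sum of 1/p supplies the second factor. *)
Lemma size_two_primes_le x z (Lam : R) s : 1 < z -> 0 <= Lam -> 0 <= x ->
  x <= z ^+ 2 * expR Lam -> uniq s ->
  (forall n, n \in s -> n%:R <= x /\ exists p q : nat,
     [/\ prime p, prime q, z <= p%:R, z <= q%:R & n = (p * q)%N]) ->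
  (size s)%:R <= 2 * x / ln z * ((8 * Lam + 4) / ln z).
Proof.
move=> z1 Lam0 x0 xz us sP; have lz : 0 < ln z by rewrite ln_gt0.
have z0 : 0 < z by rewrite (lt_trans ltr01).
pose pr y := [seq p <- iota 0 (Num.trunc y).+1 | prime p && (z <= p%:R)].
have prU y : uniq (pr y) by rewrite filter_uniq // iota_uniq.
have prP y p : 0 <= y -> (p \in pr y) = [&& prime p, z <= p%:R & p%:R <= y].
  by move=> y0; rewrite mem_filter mem_iota /= add0n ltnS truncn_ge_nat // -andbA.
have h : (size s <= size [seq (p * q)%N | p <- pr (x / z), q <- pr (x / p%:R)])%N.
  apply: uniq_leq_size => // n /sP[nx [p [q [pp pq zp zq nE]]]].
  have p0 : 0 < p%:R :> R by rewrite (lt_le_trans z0).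
  apply/allpairsPdep; exists p, q; have z0' := ltW z0; rewrite !prP ?divr_ge0 // pp pq zp zq /=.
  rewrite !ler_pdivlMr // [q%:R * _]mulrC -natrM -nE nx; split=> //.
  by rewrite (le_trans _ nx) // nE natrM ler_wpM2l // ltW.
apply: (@le_trans _ _ (\sum_(p <- pr (x / z)) (2 * (x / p%:R) / ln z))).
  apply: (@le_trans _ _ (\sum_(p <- pr (x / z)) (size (pr (x / p%:R)))%:R)).
    rewrite -natr_sum ler_nat (leq_trans h) // size_allpairs_dep sumnE big_map //.
  rewrite big_seq [leRHS]big_seq; apply: ler_sum => p pp.
  apply: size_primes_le => //; first by rewrite divr_ge0.
  by move=> q; rewrite prP ?divr_ge0 // => /and3P[].
have -> : \sum_(p <- pr (x / z)) (2 * (x / p%:R) / ln z) =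
    2 * x / ln z * \sum_(p <- pr (x / z)) p%:R^-1.
  rewrite mulr_sumr; apply: eq_bigr => p _; ring.
apply: ler_wpM2l; first by rewrite !mulr_ge0 // invr_ge0 ltW.
apply: sum_inv_primes_le => // p; rewrite prP ?divr_ge0 ?(ltW z0) //.
move=> /and3P[-> -> pz]; split=> //; apply: (le_trans pz).
by rewrite ler_pdivrMr // mulrAC -expr2.
Qed.

Lemma size_three_primes_le x z (Lam : R) s : 1 < z -> 0 <= Lam -> 0 <= x ->
  x <= z ^+ 3 * expR Lam -> uniq s ->
  (forall n, n \in s -> n%:R <= x /\ exists p q r : nat,
     [/\ prime p, prime q & prime r] /\
     [/\ z <= p%:R, z <= q%:R, z <= r%:R & n = (p * (q * r))%N]) ->
  (size s)%:R <= 2 * x / ln z * ((8 * Lam + 4) / ln z) ^+ 2.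
Proof.
move=> z1 Lam0 x0 xz us sP; have lz : 0 < ln z by rewrite ln_gt0.
have z0 : 0 < z by rewrite (lt_trans ltr01).
pose pr y := [seq p <- iota 0 (Num.trunc y).+1 | prime p && (z <= p%:R)].
have prU y : uniq (pr y) by rewrite filter_uniq // iota_uniq.
have prP y p : 0 <= y -> (p \in pr y) = [&& prime p, z <= p%:R & p%:R <= y].
  by move=> y0; rewrite mem_filter mem_iota /= add0n ltnS truncn_ge_nat // -andbA.
pose y := x / z ^+ 2; have y0 : 0 <= y by rewrite divr_ge0 // exprn_ge0 // ltW.
pose prr := [seq (p, q) | p <- pr y, q <- pr y].
have h : (size s <= size [seq (pq.1 * (pq.2 * r))%N | pq <- prr,
                          r <- pr (x / (pq.1%:R * pq.2%:R))])%N.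
  apply: uniq_leq_size => // n /sP[nx [p [q [r [[pp pq pr'] [zp zq zr nE]]]]]].
  have p0 : 0 < p%:R :> R by rewrite (lt_le_trans z0).
  have q0 : 0 < q%:R :> R by rewrite (lt_le_trans z0).
  have r0 : 0 < r%:R :> R by rewrite (lt_le_trans z0).
  have nx' : p%:R * (q%:R * r%:R) <= x by rewrite -!natrM -nE.
  apply/allpairsPdep; exists (p, q), r => /=; rewrite prP; last first.
    by rewrite divr_ge0 // mulr_ge0 // ltW.
  have bnd u v w : z <= v -> z <= w -> 0 < u -> u * (v * w) <= x -> u <= y.
    move=> zv zw u0 le; rewrite ler_pdivlMr ?exprn_gt0 //; apply: le_trans le.
    by rewrite ler_pM2l // expr2; apply: ler_pM => //; apply: ltW.
  split=> //.
    apply/allpairsP; exists (p, q); rewrite /= !prP // pp pq zp zq /=; split=> //.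
      exact: (bnd _ q%:R r%:R).
    by apply: (bnd _ p%:R r%:R) => //; rewrite mulrCA.
  rewrite pr' zr ler_pdivlMr ?mulr_gt0 //=; apply: le_trans nx'.
  by rewrite mulrC mulrA.
apply: (@le_trans _ _ (\sum_(pq <- prr) (2 * (x / (pq.1%:R * pq.2%:R)) / ln z))).
  apply: (@le_trans _ _ (\sum_(pq <- prr) (size (pr (x / (pq.1%:R * pq.2%:R))))%:R)).
    rewrite -natr_sum ler_nat (leq_trans h) // size_allpairs_dep sumnE big_map //.
  apply: ler_sum => pq _.
  have t0 : 0 <= x / (pq.1%:R * pq.2%:R) by rewrite divr_ge0 // mulr_ge0.
  by apply: size_primes_le => // q; rewrite prP // => /and3P[].
have -> : \sum_(pq <- prr) (2 * (x / (pq.1%:R * pq.2%:R)) / ln z) =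
    2 * x / ln z * (\sum_(p <- pr y) p%:R^-1) ^+ 2.
  rewrite expr2 big_distrlr mulr_sumr big_allpairs_dep /=; apply: eq_bigr => p _.
  rewrite mulr_sumr; apply: eq_bigr => q _; rewrite invfM; ring.
apply: ler_wpM2l; first by rewrite !mulr_ge0 // invr_ge0 ltW.
apply: lerXn2r.
- by rewrite nnegrE sumr_ge0 // => p _; rewrite invr_ge0.
- by rewrite nnegrE divr_ge0 ?(ltW lz) // addr_ge0 // mulr_ge0.
apply: sum_inv_primes_le => // p; rewrite prP //.
move=> /and3P[-> -> pz]; split=> //; apply: (le_trans pz).
by rewrite ler_pdivrMr ?exprn_gt0 // mulrAC -exprS.
Qed.
End chebyshev.

(** * Sieve identity and separation of variables *)

Section separation.
Variable R : realFieldType.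

Let norm_le_eq (a b E : R) : a = b -> `|b| <= E -> `|a| <= E.
Proof. by move->. Qed.

(** Orthogonality of the coordinate signs on the cube: if a and b differ, flipping f at a is an
    involution that changes the sign of every term. *)
Lemma sum_sign_pair (M : nat) (a b : 'I_M) :
  \sum_(f : {ffun 'I_M -> bool}) (-1) ^+ f a * (-1) ^+ f b =
  (a == b)%:R * 2 ^+ M :> R.
Proof.
have [->|ab] := eqVneq a b.
  rewrite (eq_bigr (fun=> 1)) => [|f _]; last by rewrite -signr_addb addbb.
  by rewrite sumr_const card_ffun card_bool card_ord mul1r -natrX.
rewrite mul0r.
pose F (f : {ffun 'I_M -> bool}) := [ffun i => f i (+) (i == a)].
have FK : involutive F by move=> f; apply/ffunP => i; rewrite !ffunE -addbA addbb addbF.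
set S := LHS; suff : S = - S by lra.
rewrite {1}/S (reindex_inj (inv_inj FK)) /= -sumrN; apply: eq_bigr => f _.
rewrite !ffunE eqxx (negPf (_ : b != a)) 1?eq_sym // addbF addbT.
by rewrite signrN mulNr.
Qed.

(* Averaging over random signs: imposing [g i = h j] on a bilinear form costs
   nothing, whatever the functions [g] and [h]. *)
Lemma bilinear_eq_le (I J : eqType) (rI : seq I) (rJ : seq J) (V : I -> J -> R)
    (g : I -> nat) (h : J -> nat) (E : R) (M : nat) :
  (forall s : nat -> R, (forall n, `|s n| <= 1) ->
    `|\sum_(i <- rI) \sum_(j <- rJ) s (g i) * s (h j) * V i j| <= E) ->
  (forall i, i \in rI -> (g i < M)%N) -> (forall j, j \in rJ -> (h j < M)%N) ->
  `|\sum_(i <- rI) \sum_(j <- rJ) (g i == h j)%:R * V i j| <= E.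
Proof.
case: M => [|M] HE gM hM.
  case: rI gM HE => [|i r] gM HE; last by have := gM i (mem_head _ _).
  by have := HE (fun=> 0) (fun=> ltac:(rewrite normr0 //)); rewrite !big_nil.
have p2 : 0 < 2 ^+ M.+1 :> R by rewrite exprn_gt0.
rewrite -(ler_pM2l p2) -[X in X * `|_|](gtr0_norm p2) -normrM.
pose s (f : {ffun 'I_M.+1 -> bool}) (n : nat) : R := (-1) ^+ f (inord n).
have -> : 2 ^+ M.+1 * (\sum_(i <- rI) \sum_(j <- rJ) (g i == h j)%:R * V i j) =
    \sum_(f : {ffun 'I_M.+1 -> bool})
      \sum_(i <- rI) \sum_(j <- rJ) s f (g i) * s f (h j) * V i j.
  rewrite [RHS]exchange_big /= mulr_sumr; apply: eq_big_seq => i /gM gi.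
  rewrite [RHS]exchange_big /= mulr_sumr; apply: eq_big_seq => j /hM hj.
  rewrite -mulr_suml sum_sign_pair -val_eqE /= !inordK //; ring.
apply: (le_trans (ler_norm_sum _ _ _)).
apply: (@le_trans _ _ (\sum_(f : {ffun 'I_M.+1 -> bool}) E)).
  apply: ler_sum => f _; apply: HE => n; rewrite /s normrX normrN1 expr1n //.
by rewrite sumr_const card_ffun card_bool card_ord -[_ *+ (_ ^ _)]mulr_natl natrX.
Qed.

(* [g i < h j] iff the binary expansions agree above some bit, which is 0 in
   [g i] and 1 in [h j]; each bit is an equality constraint. *)
Lemma bilinear_lt_le (I J : eqType) (rI : seq I) (rJ : seq J) (V : I -> J -> R)
    (E : R) (K : nat) (g : I -> nat) (h : J -> nat) :
  (forall s t : nat -> R, (forall n, `|s n| <= 1) -> (forall n, `|t n| <= 1) ->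
    `|\sum_(i <- rI) \sum_(j <- rJ) s (g i) * t (h j) * V i j| <= E) ->
  (forall i, i \in rI -> (g i < 2 ^ K)%N) ->
  (forall j, j \in rJ -> (h j < 2 ^ K)%N) ->
  `|\sum_(i <- rI) \sum_(j <- rJ) (g i < h j)%N%:R * V i j| <= K%:R * E.
Proof.
elim: K g h => [|K IH] g h HE gK hK.
  rewrite mul0r big_seq big1 ?normr0 // => i /gK; rewrite expn0 ltnS leqn0 => /eqP ->.
  rewrite big_seq big1 // => j /hK; rewrite expn0 ltnS leqn0 => /eqP ->.
  by rewrite ltnn mul0r.
have -> : \sum_(i <- rI) \sum_(j <- rJ) (g i < h j)%N%:R * V i j =
   \sum_(i <- rI) \sum_(j <- rJ) ((g i)./2 < (h j)./2)%N%:R * V i j +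
   \sum_(i <- rI) \sum_(j <- rJ) ((g i)./2 == (h j)./2)%:R *
     ((~~ odd (g i))%:R * (odd (h j))%:R * V i j).
  rewrite -big_split /=; apply: eq_bigr => i _.
  rewrite -big_split /=; apply: eq_bigr => j _.
  rewrite !mulrA -mulrDl -!natrM -natrD; congr (_%:R * _).
  have := odd_double_half (g i); have := odd_double_half (h j).
  case: odd => /=; case: odd => /=; lia.
have half_lt n : (n < 2 ^ K.+1)%N -> (n./2 < 2 ^ K)%N.
  by rewrite expnS => h1; have := odd_double_half n; lia.
rewrite -natr1 mulrDl mul1r addrC [leRHS]addrC.
apply: (le_trans (ler_normD _ _)); apply: lerD.
  apply: (@bilinear_eq_le _ _ _ _ _ (fun i => (g i)./2) (fun j => (h j)./2) _ (2 ^ K)%N).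
  (* Each parity condition depends on one variable only and is absorbed into that variable's
     sign. *)
  - move=> s s1.
    have sm n (b : bool) : `|s n * b%:R| <= 1.
      by rewrite normrM (le_trans _ (s1 n)) // ler_piMr //; case: b; rewrite ?normr1 ?normr0.
    apply: (norm_le_eq _ (HE (fun n => s n./2 * (~~ odd n)%:R)
      (fun n => s n./2 * (odd n)%:R) (fun n => sm _ _) (fun n => sm _ _))).
    by apply: eq_bigr => i _; apply: eq_bigr => j _; ring.
  - by move=> i /gK; exact: half_lt.
  - by move=> j /hK; exact: half_lt.
apply: (IH (fun i => (g i)./2) (fun j => (h j)./2)).
- move=> s t s1 t1; apply: (HE (fun n => s n./2) (fun n => t n./2)) => n; [exact: s1|exact: t1].
- by move=> i /gK; exact: half_lt.
- by move=> j /hK; exact: half_lt.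
Qed.
End separation.

(** * Dirichlet convolutions and the truncated sieve identity *)

Section dirichlet.
Variable R : realFieldType.

Let norm_le_eq (a b E : R) : a = b -> `|b| <= E -> `|a| <= E.
Proof. by move->. Qed.

Implicit Types (F : nat -> nat -> R) (V c w : nat -> R) (N : nat).

Lemma sum_multiples (a N : nat) (H : nat -> R) : (0 < a)%N ->
  (forall n, (N < n)%N -> H n = 0) ->
  \sum_(1 <= n < N.+1 | (a %| n)%N) H n = \sum_(1 <= b < N.+1) H (a * b)%N.
Proof.
move=> a0 H0; rewrite [RHS](bigID (fun b => a * b <= N)%N) /=.
rewrite [X in _ = _ + X]big1 ?addr0; last by move=> b; rewrite -ltnNge; exact: H0.
rewrite -big_filter -[RHS]big_filter -(big_map (muln a) xpredT H).
apply/perm_big/uniq_perm.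
- by rewrite filter_uniq // iota_uniq.
- rewrite map_inj_uniq ?filter_uniq ?iota_uniq // => u v /eqP.
  by rewrite eqn_pmul2l // => /eqP.
move=> n; rewrite mem_filter mem_index_iota; apply/idP/mapP.
  case/and3P=> /dvdnP[b ->] n1 nN; exists b; last by rewrite mulnC.
  by rewrite mem_filter mem_index_iota; nia.
case=> b; rewrite mem_filter mem_index_iota => /and3P[abN b1 bN] ->.
rewrite dvdn_mulr //=; nia.
Qed.

Lemma sum_divisors (n N : nat) (H : nat -> R) : (0 < n <= N)%N ->
  \sum_(a <- divisors n) H a = \sum_(1 <= a < N.+1 | (a %| n)%N) H a.
Proof.
move=> /andP[n0 nN]; rewrite -[RHS]big_filter; apply/perm_big/uniq_perm.
- exact: divisors_uniq.
- by rewrite filter_uniq // iota_uniq.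
move=> a; rewrite -dvdn_divisors // mem_filter mem_index_iota.
case an : (a %| n)%N => //=; have := dvdn_leq n0 an; have := dvdn_gt0 n0 an; lia.
Qed.

(** Grouping by n = ab. The vanishing of V beyond N lets a and b fill a square instead of the region
    under a hyperbola. *)
Lemma sum_mul_regroup F V N : (forall n, (N < n)%N -> V n = 0) ->
  \sum_(1 <= a < N.+1) \sum_(1 <= b < N.+1) F a b * V (a * b)%N =
  \sum_(1 <= n < N.+1) (\sum_(a <- divisors n) F a (n %/ a)%N) * V n.
Proof.
move=> V0.
transitivity (\sum_(1 <= a < N.+1) \sum_(1 <= n < N.+1 | (a %| n)%N) F a (n %/ a)%N * V n).
  rewrite big_nat [RHS]big_nat; apply: eq_bigr => a /andP[a1 _].
  rewrite (@sum_multiples a N (fun n => F a (n %/ a)%N * V n)) //.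
    by apply: eq_bigr => b _; rewrite mulKn.
  by move=> n /V0 ->; rewrite mulr0.
under eq_bigr do rewrite big_mkcond.
rewrite exchange_big /= big_nat [RHS]big_nat; apply: eq_bigr => n nN.
by rewrite mulr_suml (@sum_divisors n N) // -big_mkcond.
Qed.

Definition mobius (n : nat) : R :=
  if all (fun p => logn p n == 1%N) (primes n) then (-1) ^+ size (primes n) else 0.

Lemma mobius_norm_le1 n : `|mobius n| <= 1.
Proof.
by rewrite /mobius; case: ifP => _; rewrite ?normr0 // normrX normrN1 expr1n.
Qed.

Lemma mobius_sq (q d : nat) : prime q -> (0 < d)%N -> (q * q %| d)%N -> mobius d = 0.
Proof.
move=> pq d0 qd; rewrite /mobius; case: allP => // /(_ q).
have q2 : (1 < logn q d)%N by rewrite -pfactor_dvdn // expnS expn1.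
rewrite -logn_gt0 (ltnW q2) => /(_ isT) /eqP q1; by rewrite q1 in q2.
Qed.

Lemma mobius_mul (q d : nat) : prime q -> (0 < d)%N -> ~~ (q %| d)%N ->
  mobius (q * d) = - mobius d.
Proof.
move=> pq d0 qd; have q0 := prime_gt0 pq.
have P : perm_eq (primes (q * d)) (q :: primes d).
  apply: uniq_perm; rewrite /= ?primes_uniq //.
    by rewrite mem_primes (negPf qd) !andbF.
  by move=> p; rewrite primesM // primes_prime // mem_seq1 inE.
rewrite /mobius (perm_all _ P) (perm_size P) /= exprS mulN1r.
have -> : logn q (q * d) == 1%N.
  by rewrite lognM // logn_prime // eqxx lognE pq d0 (negPf qd).
rewrite andTb; have -> : all (fun p => logn p (q * d) == 1%N) (primes d) =
    all (fun p => logn p d == 1%N) (primes d).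
  apply: eq_in_all => p pd; rewrite lognM // logn_prime //.
  have [pq'|//] := eqVneq p q; move: pd; rewrite mem_primes => /and3P[_ _].
  by rewrite pq' (negPf qd).
by case: ifP => //; rewrite oppr0.
Qed.

Section sieve_identity.
Variables P Z : pred nat.
Hypothesis P_up : forall p q, (p <= q)%N -> P p -> P q.
Hypothesis Z_down : forall d e, (d <= e)%N -> Z e -> Z d.
Hypothesis Z1 : Z 1%N.

(** In the application P p means p >= z1 and Z d means d <= (x/2)^eta. *)
Definition rough (k : nat) := all P (primes k).
Definition smooth (k : nat) := all (predC P) (primes k).
Definition sieve_small (d : nat) : R := mobius d * (smooth d && Z d)%:R.
(** The d counted here have just left Z: dropping the least prime leads back into Z. They are the
    only divisors that enter the Type II sums. *)
Definition sieve_large (d : nat) : R :=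
  mobius d * [&& smooth d, ~~ Z d & Z (d %/ pdiv d)%N]%:R.

Lemma smooth_mul (q d : nat) : prime q -> (0 < d)%N ->
  smooth (q * d) = ~~ P q && smooth d.
Proof.
move=> pq d0; rewrite /smooth; apply/allP/andP => [H|[Pq H] p].
  have q0 := prime_gt0 pq; split.
    by apply: (H q); rewrite mem_primes pq muln_gt0 q0 d0 dvdn_mulr.
  by apply/allP => p pd; apply: (H p); rewrite primesM // pd orbT.
have q0 := prime_gt0 pq; rewrite primesM // primes_prime // mem_seq1.
by case/orP=> [/eqP -> //|pd]; exact: (allP H).
Qed.

Lemma sum_divisors_pair (q k : nat) (G : nat -> R) : prime q -> (0 < k)%N ->
  (q %| k)%N -> (forall d, (0 < d)%N -> (q * q %| d)%N -> G d = 0) ->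
  \sum_(d <- divisors k) G d =
  \sum_(d <- divisors k | ~~ (q %| d)%N) (G d + G (q * d)%N).
Proof.
move=> pq k0 qk G0; rewrite (bigID (fun d => q %| d)%N) /= addrC big_split /=.
congr (_ + _); rewrite (bigID (fun d => q * q %| d)%N) /=.
rewrite big_seq_cond big1 ?add0r; last first.
  move=> d /and3P[]; rewrite -dvdn_divisors // => dk _; exact/G0/(dvdn_gt0 k0).
rewrite -big_filter -[RHS]big_filter -(big_map (muln q) xpredT G).
apply/perm_big/uniq_perm.
- by rewrite filter_uniq // divisors_uniq.
- rewrite map_inj_uniq ?filter_uniq ?divisors_uniq // => u v /eqP.
  by rewrite eqn_pmul2l ?prime_gt0 // => /eqP.
move=> d; rewrite mem_filter -dvdn_divisors //; apply/idP/mapP.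
  case/andP=> /andP[/dvdnP[e ->] qq] dk; exists e; last by rewrite mulnC.
  rewrite mem_filter -dvdn_divisors // (dvdn_trans _ dk) ?dvdn_mulr // andbT.
  by apply: contra qq => ?; rewrite dvdn_mul.
case=> e; rewrite mem_filter -dvdn_divisors // => /andP[qe ek] ->.
rewrite dvdn_mulr //= dvdn_pmul2l ?prime_gt0 // qe /=.
by rewrite Gauss_dvd ?qk // prime_coprime.
Qed.

(* Legendre's formula truncated at [Z]; the discarded terms are regrouped by the
   first divisor leaving [Z]. For [k] with least prime [q] failing [P], the
   contributions of [d] and [q * d] cancel. *)
Lemma sieve_identity (k : nat) : (0 < k)%N ->
  (rough k)%:R = \sum_(d <- divisors k) (sieve_small d +
     sieve_large d * ((k %/ d == 1)%N || (pdiv d <= pdiv (k %/ d))%N)%:R).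
Proof.
move=> k0; have [rk|] := boolP (rough k).
  rewrite (bigD1_seq 1%N) /= ?divisor1 ?divisors_uniq //.
  rewrite big_seq_cond big1 ?addr0.
    rewrite /sieve_small /sieve_large /mobius /smooth /= Z1 /= expr0 mul1r mulr0 mul0r addr0 //.
  move=> d /andP[]; rewrite -dvdn_divisors // => dk d1.
  have d0 := dvdn_gt0 k0 dk.
  have pd : prime (pdiv d) by apply: pdiv_prime; lia.
  have sd : smooth d = false.
    apply/negP => /allP /(_ (pdiv d)); rewrite mem_primes pd d0 pdiv_dvd => /(_ isT) /=.
    move/negP; apply; apply: (allP rk); rewrite mem_primes pd k0.
    exact: dvdn_trans (pdiv_dvd d) dk.
  by rewrite /sieve_small /sieve_large sd /= !mulr0 mul0r addr0.
rewrite /rough => /allPn[p pk Pp]; pose q := pdiv k.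
have k1 : (1 < k)%N.
  by case: k k0 pk @q => [|[|]].
have pq : prime q by exact: pdiv_prime.
have qk : (q %| k)%N by exact: pdiv_dvd.
have qmin r : prime r -> (r %| k)%N -> (q <= r)%N.
  by move=> pr rk; apply: pdiv_min_dvd => //; exact: prime_gt1.
have Pq : ~~ P q.
  apply: contra Pp; apply: P_up; move: pk; rewrite mem_primes => /and3P[pp _].
  exact: qmin.
have pdiv_q d : (0 < d)%N -> (d %| k)%N -> (q %| d)%N -> pdiv d = q.
  move=> d0 dk qd; apply/eqP; rewrite eqn_leq pdiv_min_dvd ?prime_gt1 //=.
  apply: qmin; last exact: dvdn_trans (pdiv_dvd d) dk.
  by apply: pdiv_prime; have := dvdn_leq d0 qd; have := prime_gt1 pq; lia.
(* For d > 1 the comparison of least primes amounts to [q %| d], because the least prime q of k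
   divides d or [k %/ d]; at d = 1 the large weight vanishes. *)
pose G d := sieve_small d + sieve_large d * (q %| d)%N%:R.
transitivity (\sum_(d <- divisors k) G d); last first.
  apply: eq_big_seq => d; rewrite -dvdn_divisors // => dk.
  have d0 := dvdn_gt0 k0 dk; rewrite /G; congr (_ + _).
  have [->|d1] := eqVneq d 1%N; first by rewrite /sieve_large Z1 /= ?andbF mulr0 !mul0r.
  congr (_ * _%:R); have [qd|qd] := boolP (q %| d)%N.
    rewrite pdiv_q //; case: eqP => //= kd; suff -> : (q <= pdiv (k %/ d))%N by [].
    have kd0 : (0 < k %/ d)%N by rewrite divn_gt0 // dvdn_leq.
    have kd1 : (1 < k %/ d)%N by lia.
    by apply: qmin; [exact: pdiv_prime|exact: dvdn_trans (pdiv_dvd _) (dvdn_div dk)].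
  have qkd : (q %| k %/ d)%N.
    by move: qk; rewrite -{1}(divnK dk) Euclid_dvdM // (negPf qd) orbF.
  have kd0 : (0 < k %/ d)%N by rewrite divn_gt0 // dvdn_leq.
  have kd1 : (k %/ d == 1)%N = false.
    by apply/eqP => kd; move: qkd; rewrite kd dvdn1 => /eqP q1; rewrite q1 in pq.
  rewrite kd1 /= (pdiv_q (k %/ d)%N) ?dvdn_div //.
  suff -> : (pdiv d <= q)%N = false by [].
  have pd : prime (pdiv d) by apply: pdiv_prime; lia.
  have := qmin _ pd (dvdn_trans (pdiv_dvd d) dk); rewrite leq_eqVlt => /orP[/eqP qe|]; last lia.
  by rewrite qe pdiv_dvd in qd.
rewrite (sum_divisors_pair pq k0 qk); last first.
  by move=> d d0 qd; rewrite /G /sieve_small /sieve_large (mobius_sq pq) // !mul0r addr0.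
rewrite big_seq_cond big1 // => d /andP[]; rewrite -dvdn_divisors // => dk qd.
have d0 := dvdn_gt0 k0 dk; rewrite /G (negPf qd) mulr0 addr0 dvdn_mulr // mulr1.
have qdk : (q * d %| k)%N by rewrite Gauss_dvd ?qk // prime_coprime.
rewrite /sieve_small /sieve_large mobius_mul // smooth_mul // Pq /= pdiv_q ?dvdn_mulr //;
  last by rewrite muln_gt0 prime_gt0.
rewrite mulKn ?prime_gt0 //.
(* If Z d holds, [sieve_small d] is cancelled at q d by the small weight when Z (q d) holds and by
   the large weight otherwise; if Z d fails, so does Z (q d), and all terms are zero. *)
have := @Z_down d (q * d)%N; rewrite leq_pmull ?prime_gt0 // => /(_ isT).
case: (Z (q * d)%N) => [->//|_]; case: smooth; case: (Z d) => //=; ring.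
Qed.

Variables (N : nat) (c w : nat -> R).
Hypothesis c_le1 : forall m, `|c m| <= 1.
Hypothesis w0 : forall n, (N < n)%N -> w n = 0.

Lemma norm_sum_divisors_le (F : nat -> R) (n : nat) : (forall d, `|F d| <= 1) ->
  `|\sum_(d <- divisors n) F d| <= (tau n)%:R.
Proof.
move=> F1; apply: (le_trans (ler_norm_sum _ _ _)).
apply: (@le_trans _ _ (\sum_(d <- divisors n) 1)); first exact: ler_sum.
by rewrite big_const_seq count_predT iter_addr_0.
Qed.

(** A small d joins m to form the Type I variable. A large d stays alone as one Type II variable,
    and m and l merge into the other. The merged coefficients are divisor sums of numbers of size at
    most 1, hence bounded by [tau]. Comparing least primes bit by bit costs the factor K. *)
Lemma sieve_bilinear_bound (E1 E2 : R) (K : nat) :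
  (N.+2 <= 2 ^ K)%N ->
  (forall C : nat -> R, (forall M, `|C M| <= (tau M)%:R) ->
     (forall M, C M != 0 -> exists m d, [/\ c m != 0, Z d & M = (m * d)%N]) ->
     `|\sum_(1 <= M < N.+1) C M * \sum_(1 <= l < N.+1) w (M * l)%N| <= E1) ->
  (forall xi kappa : nat -> R, (forall d, `|xi d| <= 1) ->
     (forall n, `|kappa n| <= (tau n)%:R) ->
     (forall d, xi d != 0 -> [/\ smooth d, ~~ Z d & Z (d %/ pdiv d)%N]) ->
     `|\sum_(1 <= d < N.+1) \sum_(1 <= n < N.+1) xi d * kappa n * w (d * n)%N|
       <= E2) ->
  `|\sum_(1 <= n < N.+1)
      (\sum_(m <- divisors n) c m * (rough (n %/ m))%:R) * w n| <= E1 + K%:R * E2.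
Proof.
move=> NK HI HII.
have wM (a : nat) : (0 < a)%N -> forall n, (N < n)%N -> w (a * n)%N = 0.
  by move=> a0 n Nn; apply: w0; apply: (leq_trans Nn); rewrite leq_pmull.
pose cnd d l := ((l == 1)%N || (pdiv d <= pdiv l)%N)%:R : R.
have -> : \sum_(1 <= n < N.+1)
      (\sum_(m <- divisors n) c m * (rough (n %/ m))%:R) * w n =
   \sum_(1 <= m < N.+1) \sum_(1 <= d < N.+1) \sum_(1 <= l < N.+1)
     (c m * sieve_small d * w (m * (d * l))%N +
      sieve_large d * c m * cnd d l * w (m * (d * l))%N).
  rewrite -(@sum_mul_regroup (fun m k => c m * (rough k)%:R) w N) //.
  rewrite big_nat [RHS]big_nat; apply: eq_bigr => m /andP[m1 _].
  have H := @sum_mul_regroup (fun d l => c m * (sieve_small d + sieve_large d * cnd d l))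
    (fun k => w (m * k)%N) N (wM m m1).
  transitivity (\sum_(1 <= k < N.+1)
   (\sum_(d <- divisors k) c m * (sieve_small d + sieve_large d * cnd d (k %/ d)%N)) *
     w (m * k)%N).
    rewrite big_nat [RHS]big_nat; apply: eq_bigr => k /andP[k1 _].
    by rewrite sieve_identity // mulr_sumr.
  rewrite -H; apply: eq_bigr => d _; apply: eq_bigr => l _; ring.
under eq_bigr do under eq_bigr do rewrite big_split /=.
under eq_bigr do rewrite big_split /=.
rewrite big_split /=; apply: (le_trans (ler_normD _ _)); apply: lerD.
  pose C M := \sum_(m <- divisors M) c m * sieve_small (M %/ m)%N.
  have s1 d : `|sieve_small d| <= 1.
    rewrite /sieve_small normrM normr_nat mulr_ile1 ?mobius_norm_le1 //.
    by case: (_ && _).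
  apply: (norm_le_eq _ (HI C _ _)); first last.
  - move=> M.
    have [/hasP[m mM /andP[cm sm]] _|/hasPn H] :=
        boolP (has (fun m => (c m != 0) && (sieve_small (M %/ m)%N != 0)) (divisors M)).
      exists m, (M %/ m)%N; split=> //.
        by move: sm; rewrite /sieve_small; case: (Z _) => //; rewrite andbF mulr0 eqxx.
      have [M0|M0] := posnP M; first by move: mM; rewrite M0 inE => /eqP ->.
      by rewrite mulnC divnK // dvdn_divisors.
    rewrite /C big_seq big1 ?eqxx // => m /H; rewrite negb_and !negbK.
    by case/orP=> /eqP ->; rewrite ?mul0r ?mulr0.
  - by move=> M; apply: norm_sum_divisors_le => m; rewrite normrM mulr_ile1.
  transitivity (\sum_(1 <= l < N.+1) \sum_(1 <= m < N.+1) \sum_(1 <= d < N.+1)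
      c m * sieve_small d * w ((m * d) * l)%N).
    under eq_bigr do rewrite exchange_big /=.
    rewrite exchange_big /=; apply: eq_bigr => l _; apply: eq_bigr => m _.
    by apply: eq_bigr => d _; rewrite mulnA.
  under [RHS]eq_bigr do rewrite mulr_sumr.
  rewrite [RHS]exchange_big /= big_nat [RHS]big_nat; apply: eq_bigr => l /andP[l1 _].
  rewrite (@sum_mul_regroup (fun m d => c m * sieve_small d) (fun M => w (M * l)%N)) //.
  by move=> n Nn; rewrite mulnC; exact: wM.
(* The successor turns <= into <, and l = 1 receives N+1, above every [pdiv d] with d <= N, so the
   alternative l = 1 becomes part of one comparison. All values stay below 2^K. *)
pose hl l := if l == 1%N then N.+1 else (pdiv l).+1.
pose rJ := [seq (m, l) | m <- index_iota 1 N.+1, l <- index_iota 1 N.+1].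
pose V d (ml : nat * nat) := sieve_large d * c ml.1 * w (d * (ml.1 * ml.2))%N.
have cndE d l : (0 < d <= N)%N -> cnd d l = (pdiv d < hl l)%N%:R.
  rewrite /cnd /hl => /andP[d0 dN]; case: (l == 1)%N => //=.
  by rewrite ltnS (leq_trans (pdiv_leq d0) dN).
apply: (norm_le_eq _ (@bilinear_lt_le R nat (nat * nat)%type (index_iota 1 N.+1) rJ V E2 K
   pdiv (fun ml => hl ml.2) _ _ _)).
- rewrite exchange_big /= big_nat [RHS]big_nat; apply: eq_bigr => d d1.
  rewrite big_allpairs_dep /=; apply: eq_bigr => m _; apply: eq_bigr => l _.
  rewrite /V /= -cndE //; have -> : (d * (m * l) = m * (d * l))%N by lia.
  ring.
- move=> s t s1 t1.
  (* One sign depends on d alone and the other on l alone, so both disappear into the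
     coefficients. *)
  apply: (norm_le_eq _ (HII (fun d => s (pdiv d) * sieve_large d)
    (fun n => \sum_(m <- divisors n) c m * t (hl (n %/ m)%N)) _ _ _)).
  + rewrite big_nat [RHS]big_nat; apply: eq_bigr => d /andP[d1 _].
    rewrite big_allpairs_dep /=.
    have E := @sum_mul_regroup (fun m l => s (pdiv d) * sieve_large d * (c m * t (hl l)))
        (fun k => w (d * k)%N) N (wM d d1).
    under [RHS]eq_bigr do rewrite mulr_sumr.
    rewrite -E; apply: eq_bigr => m _; apply: eq_bigr => l _; rewrite /V /=; ring.
  + move=> d; rewrite normrM mulr_ile1 // /sieve_large normrM normr_nat.
    by rewrite mulr_ile1 ?mobius_norm_le1 //; case: [&& _, _ & _].
  + by move=> n; apply: norm_sum_divisors_le => m; rewrite normrM mulr_ile1.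
  + move=> d; rewrite /sieve_large; case: smooth; case: (Z d); case: (Z _) => //=;
    by rewrite !mulr0 eqxx.
- move=> d; rewrite mem_index_iota => /andP[d1 dN].
  have := pdiv_leq d1; lia.
- move=> [m l] /allpairsP[[m' l']] /=; rewrite !mem_index_iota => -[_ l1 [_ ->]].
  rewrite /hl; case: eqP => _; first lia.
  have := @pdiv_leq l' ltac:(lia); lia.
Qed.
End sieve_identity.
End dirichlet.

(** * Detection of primes *)

Section tau.

Lemma tau_gt0 (n : nat) : (0 < n)%N -> (0 < tau n)%N.
Proof. by move=> n0; rewrite /tau -has_predT; apply/hasP; exists 1%N; rewrite ?divisor1. Qed.

Lemma tau_prime_mul (p m : nat) : prime p -> (0 < m)%N -> (tau (p * m) <= 2 * tau m)%N.
Proof.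
move=> pp m0; rewrite /tau mul2n -addnn -[X in (_ <= _ + X)%N](size_map (muln p)) -size_cat.
apply: uniq_leq_size => [|d]; first exact: divisors_uniq.
have p0 := prime_gt0 pp; rewrite mem_cat -!dvdn_divisors ?muln_gt0 ?p0 // => dpm.
have [pd|pd] := boolP (p %| d)%N.
  apply/orP; right; apply/mapP; exists (d %/ p)%N; last by rewrite mulnC divnK.
  by rewrite -dvdn_divisors // -(@dvdn_pmul2l p) // [(p * (_ %/ _))%N]mulnC divnK.
by apply/orP; left; rewrite -(@Gauss_dvdr _ p) // coprime_sym prime_coprime.
Qed.

Lemma tau_two_primes (p q : nat) : prime p -> prime q -> (tau (p * q) <= 4)%N.
Proof.
move=> pp pq; have := tau_prime_mul pp (prime_gt0 pq).
have := @tau_prime_mul q 1 pq isT; rewrite muln1 -[tau 1]/1%N; lia.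
Qed.

Lemma tau_three_primes (p q r : nat) :
  prime p -> prime q -> prime r -> (tau (p * (q * r)) <= 8)%N.
Proof.
move=> pp pq pr; have := tau_two_primes pq pr.
have := @tau_prime_mul p (q * r) pp; rewrite muln_gt0 !prime_gt0 // => /(_ isT); lia.
Qed.
End tau.

Section rough_numbers.
Variable R : realType.
Variables (x z1 z2 : R).
Hypotheses (z1_gt1 : 1 < z1) (z1x : z1 <= x / 2) (z14 : x < z1 ^+ 4).
Hypotheses (z2_ge1 : 1 <= z2) (z2x : z2 ^+ 2 <= x / 2).
Let P (p : nat) := z1 <= p%:R.

Lemma pdiv_rough (k : nat) : (1 < k)%N -> rough P k -> prime (pdiv k) /\ z1 <= (pdiv k)%:R.
Proof.
move=> k1 /allP rk; have pk := pdiv_prime k1; split=> //; apply: rk.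
by rewrite mem_primes pk pdiv_dvd; lia.
Qed.

Lemma rough_dvd (d k : nat) : (0 < k)%N -> (d %| k)%N -> rough P k -> rough P d.
Proof.
move=> k0 dk /allP rk; apply/allP => p; rewrite mem_primes => /and3P[pp _ pd].
by apply: rk; rewrite mem_primes pp k0 (dvdn_trans pd).
Qed.

Lemma rough_ge (k : nat) : (1 < k)%N -> rough P k -> z1 <= k%:R.
Proof.
move=> k1 rk; have [_ zk] := pdiv_rough k1 rk; apply: (le_trans zk).
by rewrite ler_nat; apply: pdiv_leq; lia.
Qed.

Lemma rough_split (k : nat) : (1 < k)%N -> rough P k -> ~~ prime k ->
  exists p l, [/\ prime p, z1 <= p%:R, (1 < l)%N, rough P l & k = (p * l)%N] /\ (p = pdiv k)%N.
Proof.
move=> k1 rk nk; have [pk zk] := pdiv_rough k1 rk.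
have kE : k = (pdiv k * (k %/ pdiv k))%N by rewrite mulnC divnK // pdiv_dvd.
exists (pdiv k), (k %/ pdiv k)%N; split=> //; split=> //.
  have k0 := ltnW k1; have : (0 < k %/ pdiv k)%N by rewrite divn_gt0 ?pdiv_gt0 // pdiv_leq.
  rewrite leq_eqVlt => /orP[/eqP e|//]; move: nk; rewrite kE -e muln1 pk //.
by apply: (@rough_dvd _ k) => //; [exact: ltnW|apply/dvdn_div/pdiv_dvd].
Qed.

Definition prime_weight (m : nat) : R :=
  (m == 1)%N%:R - [&& prime m, z1 <= m%:R & m%:R <= z2]%:R.

Definition rough_prime_weight (n : nat) : R :=
  \sum_(m <- divisors n) prime_weight m * (rough P (n %/ m)%N)%:R.

Lemma prime_weight1 : prime_weight 1 = 1.
Proof. by rewrite /prime_weight /= subr0. Qed.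

Lemma prime_weight_norm_le1 m : `|prime_weight m| <= 1.
Proof.
rewrite /prime_weight; have [->|_] := eqVneq m 1%N; first by rewrite /= subr0 normr1.
by rewrite sub0r normrN normr_nat; case: [&& _, _ & _].
Qed.

Lemma prime_weight_neq0 m : prime_weight m != 0 ->
  m = 1%N \/ [/\ prime m, z1 <= m%:R & m%:R <= z2].
Proof.
rewrite /prime_weight; have [->|_] := eqVneq m 1%N; first by left.
by case: and3P => [|_]; [right|rewrite subr0 eqxx].
Qed.

(** The weight is one step of Buchstab's identity. If n = pq is rough with p <= q and p <= z2, then
    q > z2 because z2^2 <= x/2 < n, so exactly one term is subtracted from 1. A prime n exceeds z2
    and loses nothing. Four prime factors are excluded by n <= x < z1^4. *)
Lemma prime_detection (n : nat) : dyadic x n ->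
  (prime n)%:R = rough_prime_weight n \/
  (exists p q : nat, [/\ prime p, prime q, z2 <= p%:R, z2 <= q%:R & n = (p * q)%N]) \/
  (exists p q r : nat, [/\ prime p, prime q & prime r] /\
     [/\ z1 <= p%:R, z1 <= q%:R, z1 <= r%:R & n = (p * (q * r))%N]).
Proof.
case/andP=> xn nx; have z10 : 0 < z1 by rewrite (lt_trans ltr01).
have n0 : (0 < n)%N.
  by rewrite -(ltr0n R) (le_lt_trans _ xn) // (le_trans _ z1x) // ltW.
have z1n : z1 < n%:R by rewrite (le_lt_trans z1x).
have n1 : (1 < n)%N by rewrite -(ltr1n R) (lt_trans z1_gt1).
have z2n : z2 < n%:R.
  by apply: le_lt_trans xn; apply: le_trans z2x; rewrite expr2 ler_peMr // (le_trans ler01).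
have [rn|nrn] := boolP (rough P n); last first.
  left; rewrite /rough_prime_weight big_seq big1.
    case pn : (prime n) => //; move: nrn; rewrite /rough primes_prime //= /P (ltW z1n) //.
  move=> m; rewrite -dvdn_divisors // => mn; have m0 := dvdn_gt0 n0 mn.
  have [->|/prime_weight_neq0[->|[pm zm _]]] := eqVneq (prime_weight m) 0.
  - by rewrite mul0r.
  - by rewrite divn1 (negPf nrn) mulr0.
  (* The prime m is itself at least z1, so n would inherit roughness from [n %/ m]. *)
  suff -> : rough P (n %/ m)%N = false by rewrite mulr0.
  apply/negP => rnm; move/negP: nrn; apply; apply/allP => p.
  have nm0 : (0 < n %/ m)%N by rewrite divn_gt0 // dvdn_leq.
  rewrite mem_primes => /and3P[pp _]; rewrite -{1}(divnK mn) Euclid_dvdM // => /orP[pnm|].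
    by apply: (allP rnm); rewrite mem_primes pp nm0.
  by rewrite dvdn_prime2 // => /eqP ->.
have [pn|npn] := boolP (prime n).
  left; rewrite /rough_prime_weight (bigD1_seq 1%N) ?divisor1 ?divisors_uniq //=.
  rewrite divn1 rn prime_weight1 mulr1 big_seq_cond big1 ?addr0 // => m /andP[].
  rewrite -dvdn_divisors // => /(primeP pn).2 /orP[->//|/eqP -> _].
  have [->|/prime_weight_neq0[n1'|[_ _]]] := eqVneq (prime_weight n) 0.
  - by rewrite mul0r.
  - by rewrite n1' in n1.
  - by rewrite leNgt z2n.
have [p [k [[pp zp k1 rk nE] pE]]] := rough_split n1 rn npn.
have [pk|npk] := boolP (prime k); last first.
  have [q [l [[pq zq l1 rl kE] qE]]] := rough_split k1 rk npk.
  have [pl|npl] := boolP (prime l).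
    right; right; exists p, q, l; split=> //; split=> //; last by rewrite nE kE.
    exact: rough_ge.
  exfalso; have [r [j [[pr zr j1 rj lE] rE]]] := rough_split l1 rl npl.
  have zj := rough_ge j1 rj.
  have : z1 ^+ 4 <= n%:R.
    rewrite nE kE lE !natrM; have -> : z1 ^+ 4 = z1 * (z1 * (z1 * z1)) by ring.
    have z10' := ltW z10.
    by do 3! (apply: ler_pM; rewrite ?mulr_ge0 //).
  by rewrite leNgt (le_lt_trans nx).
have [pz2|z2p] := leP p%:R z2; last first.
  right; left; exists p, k; split=> //; first exact: ltW.
  rewrite (le_trans (ltW z2p)) // ler_nat pE; apply: pdiv_min_dvd => //.
  by rewrite nE dvdn_mull.
left; have z2k : z2 < k%:R.
  rewrite ltNge; apply/negP => kz2; move: xn; rewrite ltNge => /negP; apply.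
  by apply: le_trans z2x; rewrite nE natrM expr2 ler_pM.
have p1 : p != 1%N by apply/eqP => p1; rewrite p1 in pp.
rewrite /rough_prime_weight (bigD1_seq 1%N) ?divisor1 ?divisors_uniq //=.
have pdn : p \in divisors n by rewrite -dvdn_divisors // nE dvdn_mulr.
rewrite big_mkcond (bigD1_seq p) ?divisors_uniq //= p1 big_seq_cond big1 ?addr0; last first.
  move=> m /andP[]; rewrite -dvdn_divisors // => mn mp; case: ifP => // m1.
  have [->|/prime_weight_neq0[m1'|[pm _ mz2]]] := eqVneq (prime_weight m) 0.
  - by rewrite mul0r.
  - by rewrite m1' in m1.
  move: mn; rewrite nE Euclid_dvdM // !dvdn_prime2 // (negPf mp) => /eqP mk.
  by move: mz2; rewrite mk leNgt z2k.
rewrite divn1 rn prime_weight1 nE mulKn ?prime_gt0 // rk /prime_weight.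
by rewrite (negPf p1) pp zp pz2 /= sub0r !mulr1 subrr.
Qed.

Variables (rho L Lam : R) (w : nat -> R).
Hypotheses (rho0 : 0 <= rho) (L_gt0 : 0 < L) (Lam0 : 0 <= Lam).
Hypotheses (z1L : L / 4 <= ln z1) (z2L : L / 4 <= ln z2) (z2_gt1 : 1 < z2).
Hypotheses (xz1 : x <= z1 ^+ 3 * expR Lam) (xz2 : x <= z2 ^+ 2 * expR Lam).
Hypothesis w_supp : supported x w.
Hypothesis w_tau : forall n, dyadic x n -> `|w n| <= tau_pow rho n.

(** Only the exceptional n of [prime_detection] contribute. They have at most three prime factors,
    so their [tau] is at most 8, |w n| is at most 8^rho and the coefficient is at most 1 + 8 = 9.
    The lower bound L/4 for ln z1 and ln z2 expresses the counts through L. *)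
Lemma prime_sum_rough_weight :
  `|prime_sum x w - \sum_(1 <= n < (Num.trunc x).+1) rough_prime_weight n * w n| <=
  9 * 8 `^ rho * (8 * x / L * (4 * (8 * Lam + 4) / L + (4 * (8 * Lam + 4) / L) ^+ 2)).
Proof.
have x0 : 0 <= x by move: z1_gt1 z1x; lra.
set N := Num.trunc x; pose G n := ((prime n)%:R - rough_prime_weight n) * w n.
have -> : prime_sum x w - \sum_(1 <= n < N.+1) rough_prime_weight n * w n =
    \sum_(1 <= n < N.+1) G n.
  rewrite /prime_sum big_mkcond /= -sumrB; apply: eq_bigr => n _.
  by rewrite /G mulrBl; case: prime; rewrite ?mul1r ?mul0r.
pose bad n := dyadic x n && ((prime n)%:R != rough_prime_weight n).
pose two n := `[< exists p q : nat, [/\ prime p, prime q, z2 <= p%:R, z2 <= q%:R & n = (p * q)%N] >].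
pose s := [seq n <- index_iota 1 N.+1 | bad n].
have s_uniq : uniq s by rewrite filter_uniq // iota_uniq.
have sx n : n \in s -> n%:R <= x.
  by rewrite mem_filter => /andP[/andP[/andP[]]].
have s3P n : n \in s -> ~~ two n -> exists p q r : nat, [/\ prime p, prime q & prime r] /\
     [/\ z1 <= p%:R, z1 <= q%:R, z1 <= r%:R & n = (p * (q * r))%N].
  rewrite mem_filter => /andP[/andP[dn gn] _] /asboolP ntwo.
  by case: (prime_detection dn) => [e|[//|//]]; rewrite e eqxx in gn.
have -> : \sum_(1 <= n < N.+1) G n = \sum_(n <- s) G n.
  rewrite big_filter [RHS]big_mkcond /=; apply: eq_bigr => n _; case: ifP => // /negbT.
  rewrite /bad /G negb_and negbK => /orP[/w_supp ->|/eqP ->]; first by rewrite mulr0.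
  by rewrite subrr mul0r.
have p8 : 0 <= 8 `^ rho by exact: powR_ge0.
have tau8 n : n \in s -> (tau n <= 8)%N.
  move=> ns; have [/asboolP[p [q [pp pq _ _ ->]]]|/(s3P _ ns)[p [q [r [[pp pq pr] [_ _ _ ->]]]]]] :=
    boolP (two n).
    by apply: (leq_trans (tau_two_primes pp pq)).
  exact: tau_three_primes.
apply: (@le_trans _ _ (\sum_(n <- s) 9 * 8 `^ rho)).
  apply: (le_trans (ler_norm_sum _ _ _)); rewrite big_seq [leRHS]big_seq.
  apply: ler_sum => n ns; rewrite /G normrM; have t8 := tau8 n ns; apply: ler_pM => //.
    apply: (le_trans (ler_normB _ _)); rewrite [leRHS](_ : 9 = 1 + 8 :> R); last by lra.
    apply: lerD; first by rewrite normr_nat; case: prime.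
    apply: (@le_trans _ _ (tau n)%:R); last by rewrite ler_nat.
    apply: norm_sum_divisors_le => m.
    rewrite normrM normr_nat mulr_ile1 ?prime_weight_norm_le1 //; by case: rough.
  move: ns; rewrite mem_filter => /andP[/andP[dn _] _].
  apply: (le_trans (w_tau dn)); apply: ge0_ler_powR; rewrite ?nnegrE // ler_nat //.
rewrite big_const_seq count_predT iter_addr_0 -[_ *+ size s]mulr_natr.
apply: ler_wpM2l; first by rewrite mulr_ge0.
pose b := 4 * (8 * Lam + 4) / L.
have iL z : L / 4 <= ln z -> (ln z)^-1 <= 4 / L.
  move=> zL; have L4 : 0 < L / 4 by rewrite divr_gt0.
  by rewrite -[4 / L]invrK invf_div lef_pV2 // posrE (lt_le_trans L4).
have lz_ge0 z : L / 4 <= ln z -> 0 <= (ln z)^-1.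
  by move=> zL; rewrite invr_ge0 (le_trans _ zL) // divr_ge0 // ltW.
have hb z : L / 4 <= ln z -> 0 <= (8 * Lam + 4) / ln z <= b.
  move=> zL; apply/andP; split.
    by rewrite mulr_ge0 ?lz_ge0 // addr_ge0 // mulr_ge0.
  rewrite /b -mulrA mulrCA; apply: ler_wpM2l; last exact: iL.
  by rewrite addr_ge0 // mulr_ge0.
have h8 z : L / 4 <= ln z -> 0 <= 2 * x / ln z <= 8 * x / L.
  move=> zL; apply/andP; split; first by rewrite !mulr_ge0 ?lz_ge0.
  have -> : 8 * x / L = 2 * x * (4 / L) by lra.
  by apply: ler_wpM2l; [rewrite mulr_ge0|exact: iL].
have [b0 _] := andP (hb _ z1L).
rewrite -(count_predC two s) -!size_filter natrD mulrDr; apply: lerD.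
  apply: (le_trans (@size_two_primes_le _ x z2 Lam _ _ _ _ _ _ _)) => //.
  - by rewrite filter_uniq.
  - move=> n; rewrite mem_filter => /andP[/asboolP tn ns]; split=> //; exact: sx.
  have /andP[? ?] := hb _ z2L; have /andP[? ?] := h8 _ z2L.
  exact: ler_pM.
apply: (le_trans (@size_three_primes_le _ x z1 Lam _ _ _ _ _ _ _)) => //.
- by rewrite filter_uniq.
- move=> n; rewrite mem_filter => /andP[tn ns]; split; [exact: sx|exact: s3P].
have /andP[? hb1] := hb _ z1L; have /andP[? ?] := h8 _ z1L.
apply: ler_pM => //; first by rewrite exprn_ge0.
by apply: lerXn2r; rewrite ?nnegrE // (le_trans _ hb1).
Qed.
End rough_numbers.

(** * Sums controlled by the Type I and Type II conditions *)

Section type_conditions.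
Variable R : realType.
Implicit Types (x B : R) (w : nat -> R) (P : triple R).

Lemma tau_le_pow B (n : nat) : 1 <= B -> (0 < n)%N -> (tau n)%:R <= tau_pow B n :> R.
Proof. by move=> B1 n0; rewrite /tau_pow le1r_powR // ler1n tau_gt0. Qed.

Lemma norm_sum_le_max_interval_sum x w (m : nat) : supported x w ->
  `|\sum_(1 <= n < (Num.trunc x).+1) w (m * n)%N| <= max_interval_sum x w m.
Proof.
move=> ws; apply: ub_le_sup.
  exists (\sum_(1 <= n < (Num.trunc x).+1) `|w (m * n)%N|) => _ [I _ <-].
  apply: (le_trans (ler_norm_sum _ _ _)); rewrite big_mkcond /=.
  by apply: ler_sum => n _; case: ifP.
exists `]-oo, +oo[ => //; congr `|_|; rewrite big_mkcond; apply: eq_bigr => n _.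
by rewrite in_itv /= andbT; case: ifPn => // /ws.
Qed.

Lemma type_I_sum P B x w (C : nat -> R) : 1 <= B -> 1 <= x -> gamma P <= 1 -> supported x w ->
  type_I P B x w -> (forall M, `|C M| <= (tau M)%:R) ->
  (forall M, C M != 0 -> M%:R <= x `^ gamma P) ->
  `|\sum_(1 <= M < (Num.trunc x).+1) C M * \sum_(1 <= l < (Num.trunc x).+1) w (M * l)%N|
  <= x / ln x `^ B.
Proof.
move=> B1 x1 g1 ws tI H H0; apply: le_trans tI; apply: (le_trans (ler_norm_sum _ _ _)).
have TN : (Num.trunc (x `^ gamma P) <= Num.trunc x)%N.
  apply: le_truncn; have := @ler_powR R x x1 _ _ g1; rewrite powRr1 //; lra.
rewrite (@big_cat_nat _ _ _ (Num.trunc (x `^ gamma P)).+1) //=.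
rewrite [X in _ + X]big_nat [X in _ + X]big1 ?addr0; last first.
  move=> M /andP[TM _]; have [->|/H0 ] := eqVneq (C M) 0; first by rewrite mul0r normr0.
  by rewrite leNgt -truncn_lt_nat ?powR_ge0 // TM.
rewrite big_nat [leRHS]big_nat; apply: ler_sum => M /andP[M1 _]; rewrite normrM.
apply: ler_pM => //; last exact: norm_sum_le_max_interval_sum.
exact: le_trans (H M) (tau_le_pow B1 M1).
Qed.

Lemma type_II_sum P B x w (xi kappa : nat -> R) : 1 <= B -> supported x w ->
  type_II P B x w -> (forall d, `|xi d| <= 1) -> (forall n, `|kappa n| <= (tau n)%:R) ->
  (forall d, xi d != 0 -> (x / 2) `^ theta P < d%:R <= x `^ (theta P + nu P)) ->
  `|\sum_(1 <= d < (Num.trunc x).+1) \sum_(1 <= n < (Num.trunc x).+1)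
      xi d * kappa n * w (d * n)%N| <= x / ln x `^ B.
Proof.
move=> B1 ws tII xi1 kap xiS.
have nC (r : R) : `|r%:C%C| = (`|r|)%:C%C by rewrite normc_def /= expr0n addr0 sqrtr_sqr.
have := tII (fun m => (xi m)%:C%C) (fun n => (kappa n)%:C%C).
set S := \sum_(1 <= d < _) _.
set T := \sum_(1 <= m < _ | _) _ => H.
have TS : T = S%:C%C.
  rewrite /T /S big_mkcond rmorph_sum; apply: eq_bigr => d _.
  case: ifPn => [_|dS]; last first.
    have -> : xi d = 0 by apply/eqP; apply: contraNT dS => /xiS.
    by rewrite big1 ?rmorph0 // => n _; rewrite !mul0r.
  rewrite rmorph_sum big_mkcond; apply: eq_bigr => n _; case: ifPn => [_|/ws ->].
    by rewrite !rmorphM.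
  by rewrite mulr0 rmorph0.
rewrite TS nC lecR in H; apply: H => m m0; rewrite nC lecR.
  apply: (le_trans (xi1 m)); apply: le_trans (tau_le_pow B1 m0).
  by rewrite ler1n tau_gt0.
exact: le_trans (kap m) (tau_le_pow B1 m0).
Qed.
End type_conditions.

(** * The sum of w over primes *)

Section prime_sum_bound.
Variable R : realType.
Implicit Types (x rho nu eps eta : R) (w : nat -> R).

Lemma ln2_ge_half : 2^-1 <= ln 2 :> R.
Proof.
have := @le_ln1Dx R (- 2^-1); have -> : 1 + - 2^-1 = 2^-1 :> R by lra.
by rewrite lnV ?posrE // => /(_ ltac:(lra)); lra.
Qed.

Lemma trunc_log2_gt (n : nat) : (n.+2 <= 2 ^ (trunc_log 2 n).+2)%N.
Proof.
rewrite expnS; have := @trunc_log_ltn 2 n isT; have : (0 < 2 ^ (trunc_log 2 n))%N by rewrite expn_gt0.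
by rewrite expnS; move: (2 ^ _)%N => a; lia.
Qed.

Lemma trunc_log2_le x : 1 <= x -> (trunc_log 2 (Num.trunc x))%:R <= 2 * ln x.
Proof.
move=> x1; have x0 : 0 < x by rewrite (lt_le_trans ltr01).
have N0 : (0 < Num.trunc x)%N by rewrite truncn_gt0.
have := @trunc_logP 2 _ isT N0; rewrite -(ler_nat R) natrX => h.
have {h} : 2 ^+ trunc_log 2 (Num.trunc x) <= x.
  by apply: le_trans h _; have /andP[] := truncn_itv (ltW x0).
rewrite -ler_ln ?posrE ?exprn_gt0 // lnXn // -[_ *+ trunc_log _ _]mulr_natl.
have := ler_wpM2l (ler0n R (trunc_log 2 (Num.trunc x))) ln2_ge_half.
lra.
Qed.

(** Here b stands for 4 (8 Lam + 4) / L with Lam = 4 eta L, and e for eta. The constant 131 = 128 +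
    3 comes from 16 <= 3 eta L; since 131/20 < 7, b + b^2 is at most 8 times 131 eta. *)
Lemma bad_bound_numeric (p y e b : R) : 0 <= p -> 0 <= y -> 0 <= b ->
  b <= 131 * e -> e <= 20^-1 ->
  9 * p * (8 * y * (b + b ^+ 2)) <= 72 * (8 * 131) * (p * (e * y)).
Proof.
move=> p0 y0 b0 be e20.
have bb : b + b ^+ 2 <= 8 * (131 * e) by nra.
have -> : 9 * p * (8 * y * (b + b ^+ 2)) = 72 * (p * y) * (b + b ^+ 2) by ring.
apply: le_trans (_ : 72 * (p * y) * (8 * (131 * e)) <= _).
  by apply: ler_wpM2l => //; rewrite !mulr_ge0.
rewrite le_eqVlt; apply/orP; left; apply/eqP; ring.
Qed.

Lemma prime_sum_bound rho nu eps eta x w :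
  1 <= rho -> 3^-1 <= nu < 2^-1 -> 0 <= eps <= eta -> 0 < eta <= 20^-1 ->
  6 / eta <= ln x -> 0 < x ->
  let P := Triple (2^-1 - eps) eps (nu - 2 * eps) in
  supported x w -> (forall n, dyadic x n -> `|w n| <= tau_pow rho n) ->
  type_I P 3 x w -> type_II P 3 x w ->
  `|prime_sum x w| <= 10 ^+ 5 * 8 `^ rho * eta * (x / ln x).
Proof.
move=> rho1 /andP[nu1 nu2] /andP[eps0 eps1] /andP[eta0 eta1] Lx x0 P ws wtau tI tII.
set L := ln x; rewrite -/L in Lx.
pose A := eta * L; pose U := nu * L; pose V := eps * L.
have A6 : 6 <= A by move: Lx; rewrite ler_pdivrMr // mulrC.
have L0 : 0 < L by rewrite (lt_le_trans _ Lx) // divr_gt0.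
have LA : 20 * A <= L by rewrite /A; nra.
have U1 : L / 3 <= U by rewrite /U; nra.
have U2 : U <= L / 2 by rewrite /U; nra.
have V0 : 0 <= V by rewrite /V mulr_ge0 // ltW.
have VA : V <= A by rewrite /V /A ler_pM2r.
have xE : x = expR L by rewrite lnK // posrE.
have ln2a := ln2_le1 R; have ln2b := ln2_ge_half.
have x2E : x / 2 = expR (L - ln 2) by rewrite expRB lnK ?posrE // -xE.
have xh0 : 0 < x / 2 by rewrite divr_gt0.
have powE a : x `^ a = expR (a * L) by rewrite /powR gt_eqF.
have powE2 a : (x / 2) `^ a = expR (a * (L - ln 2)).
  by rewrite /powR gt_eqF // x2E expRK.
have e1 y : 0 <= y -> 1 <= expR y :> R by move=> y0; rewrite -expR0 ler_expR.
have x1 : 1 <= x by rewrite xE; apply: e1; lra.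
pose z1 := expR (U - A); pose z2 := expR (L / 2 - 2 * A).
pose z0 := (x / 2) `^ eta.
have z0E : z0 = expR (A - eta * ln 2) by rewrite /z0 powE2 mulrBr.
have eln : 0 <= eta * ln 2 <= 1.
  apply/andP; split; first by apply: mulr_ge0; lra.
  by apply: (@le_trans _ _ (eta * 1)); [apply: ler_wpM2l; lra|lra].
have z0_1 : 1 <= z0 by rewrite z0E; apply: e1; lra.
pose Pp (p : nat) := z1 <= p%:R; pose Z (d : nat) := d%:R <= z0.
have Pup p q : (p <= q)%N -> Pp p -> Pp q.
  by move=> pq zp; rewrite /Pp (le_trans zp) // ler_nat.
have Zdown d e : (d <= e)%N -> Z e -> Z d.
  by move=> de; apply: le_trans; rewrite ler_nat.
have z1_gt1 : 1 < z1 by rewrite expR_gt1; lra.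
have z2_gt1 : 1 < z2 by rewrite expR_gt1; lra.
have z1x : z1 <= x / 2 by rewrite x2E ler_expR; lra.
have z14 : x < z1 ^+ 4 by rewrite xE -expRM_natl ltr_expR; lra.
have z2x : z2 ^+ 2 <= x / 2 by rewrite x2E -expRM_natl ler_expR; lra.
have w0 n : (Num.trunc x < n)%N -> w n = 0.
  move=> nx; apply: ws; rewrite /dyadic negb_and -!ltNge; apply/orP; right.
  by rewrite -truncn_lt_nat // ltW.
have B1 : 1 <= 3 :> R by lra.
(* The width Lam = 4 A fits both kinds of exception: z2^2 exp(4A) = x, and z1^3 exp(3A) >= x because
   nu >= 1/3. *)
have main := @prime_sum_rough_weight R x z1 z2 z1_gt1 z1x z14 (ltW z2_gt1) z2x
  rho L (4 * A) w ltac:(lra) L0 ltac:(lra) ltac:(rewrite expRK; lra)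
  ltac:(rewrite expRK; lra) z2_gt1
  ltac:(rewrite xE -expRM_natl -expRD ler_expR; lra)
  ltac:(rewrite xE -expRM_natl -expRD ler_expR; lra) ws wtau.
pose K := (trunc_log 2 (Num.trunc x)).+2.
have NK : ((Num.trunc x).+2 <= 2 ^ K)%N.
  exact: trunc_log2_gt.
have KL : K%:R <= 2 * L + 2.
  have -> : K%:R = (trunc_log 2 (Num.trunc x))%:R + 2 :> R by rewrite -(natrD _ _ 2) addn2.
  by rewrite lerD2r; exact: trunc_log2_le.
have E1 : x / ln x `^ 3 = x / L ^+ 3 by rewrite -/L (powR_mulrn 3) // ltW.
have sieve := @sieve_bilinear_bound R Pp Z Pup Zdown z0_1 (Num.trunc x)
  (prime_weight z1 z2) w (@prime_weight_norm_le1 R z1 z2) w0 (x / L ^+ 3) (x / L ^+ 3) K NK.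
have {}sieve : `|\sum_(1 <= n < (Num.trunc x).+1) rough_prime_weight z1 z2 n * w n| <=
    x / L ^+ 3 + K%:R * (x / L ^+ 3).
  apply: sieve.
    move=> C C1 CS; rewrite -E1; apply: (type_I_sum B1 x1 _ ws tI C1) => [|M /CS] /=; first lra.
    move=> [m [d [cm dz ->]]]; rewrite natrM powE.
    have mz : m%:R <= z2.
      by case: (prime_weight_neq0 cm) => [->|[]//]; exact: ltW.
    apply: (@le_trans _ _ (z2 * z0)); first exact: ler_pM.
    by rewrite z0E -expRD ler_expR mulrBl -/V; lra.
  move=> xi kappa xi1 kap xiS; rewrite -E1; apply: (type_II_sum B1 ws tII xi1 kap).
  move=> d /xiS[sd /=]; rewrite -ltNge => dz Zd; apply/andP; split.
    apply: le_lt_trans dz; rewrite z0E powE2 ler_expR mulrBr -/V.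
    have : eta * ln 2 - eps * ln 2 <= (eta - eps) * 1.
      by rewrite -mulrBl; apply: ler_wpM2l; lra.
    have : (eta - eps) * 1 <= (eta - eps) * L by apply: ler_wpM2l; lra.
    rewrite /V /A; lra.
  rewrite powE; have -> : (eps + (nu - 2 * eps)) * L = U - V by rewrite /U /V; ring.
  have d1 : (1 < d)%N by rewrite -(ltr1n R) (le_lt_trans z0_1).
  have pd := pdiv_prime d1.
  (* A prime d lies below z1 by smoothness. Otherwise [pdiv d] is at most [d %/ pdiv d], which is at
     most z0, so d <= z0^2, well inside the Type II range. *)
  have [dp|dnp] := boolP (prime d).
    move: sd; rewrite /smooth primes_prime //= andbT -ltNge => /ltW dz1.
    by apply: (le_trans dz1); rewrite ler_expR; lra.
  have dE : d = (pdiv d * (d %/ pdiv d))%N by rewrite mulnC divnK // pdiv_dvd.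
  have dp1 : (1 < d %/ pdiv d)%N.
    have d0 := ltnW d1; have : (0 < d %/ pdiv d)%N by rewrite divn_gt0 ?pdiv_gt0 // pdiv_leq.
    by rewrite leq_eqVlt => /orP[/eqP e|//]; move: dnp; rewrite dE -e muln1 pd.
  have pe : (pdiv d <= d %/ pdiv d)%N.
    by apply: pdiv_min_dvd => //; apply/dvdn_div/pdiv_dvd.
  rewrite dE natrM; apply: (@le_trans _ _ (z0 * z0)).
    by apply: ler_pM => //; apply: le_trans Zd; rewrite ler_nat.
  by rewrite z0E -expRD ler_expR; lra.
have xL : 0 <= x / L by rewrite divr_ge0 // ltW.
(* The exponent B = 3 still leaves O(x / L^2) after the loss of K = O(L), and eta L >= 6 absorbs the
   constant. *)
have err : x / L ^+ 3 + K%:R * (x / L ^+ 3) <= eta * (x / L).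
  have -> : x / L ^+ 3 + K%:R * (x / L ^+ 3) = (1 + K%:R) / L ^+ 2 * (x / L).
    by field; rewrite gt_eqF.
  apply: ler_wpM2r => //; rewrite ler_pdivrMr ?exprn_gt0 //.
  have -> : eta * L ^+ 2 = A * L by rewrite /A; ring.
  have : 6 * L <= A * L by rewrite ler_pM2r.
  by lra.
pose p8 := 8 `^ rho : R.
have p8_1 : 1 <= p8.
  have := @ler_powR R 8 ltac:(by rewrite ler1n) 0 rho (le_trans ler01 rho1).
  by rewrite powRr0.
have eta_xL : 0 <= eta * (x / L) by rewrite mulr_ge0 // ltW.
have main' : 9 * p8 * (8 * x / L * (4 * (8 * (4 * A) + 4) / L +
    (4 * (8 * (4 * A) + 4) / L) ^+ 2)) <= 72 * (8 * 131) * (p8 * (eta * (x / L))).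
  have bE : 4 * (8 * (4 * A) + 4) / L <= 131 * eta.
    by rewrite ler_pdivrMr // -mulrA -/A; lra.
  rewrite -[8 * x / L]mulrA; apply: bad_bound_numeric => //; first lra.
  by rewrite divr_ge0 ?(ltW L0) //; lra.
have p8m : eta * (x / L) <= p8 * (eta * (x / L)) by rewrite ler_peMl.
move: main main' sieve err p8m; rewrite -/p8.
set S := \sum_(1 <= n < _) _; set T := prime_sum x w => h1 h2 h3 h4 h5.
have -> : T = (T - S) + S by ring.
apply: (le_trans (ler_normD _ _)).
have c5 : 72 * (8 * 131) + 1 <= 10 ^+ 5 :> R by rewrite !exprS expr0; lra.
have -> : 10 ^+ 5 * p8 * eta * (x / L) = 10 ^+ 5 * (p8 * (eta * (x / L))) by ring.
have h6 : 0 <= p8 * (eta * (x / L)) by apply: le_trans h5.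
have := ler_wpM2r h6 c5; rewrite mulrDl mul1r.
move: h1 h2 h3 h4 h5; set c := _ * (8 * 131); lra.
Qed.

(** For x >= 4 the primes in (x/2, x] are at least sqrt x, so Chebyshev's bound with z = sqrt x
    counts them; each has [tau] at most 2. *)
Lemma prime_sum_trivial_bound rho x w : 1 <= rho -> 4 <= x ->
  supported x w -> (forall n, dyadic x n -> `|w n| <= tau_pow rho n) ->
  `|prime_sum x w| <= 4 * 2 `^ rho * (x / ln x).
Proof.
move=> rho1 x4 ws wt; have x0 : 0 < x by lra.
pose s := [seq p <- index_iota 1 (Num.trunc x).+1 | prime p && dyadic x p].
have -> : prime_sum x w = \sum_(p <- s) w p.
  rewrite /prime_sum big_filter big_mkcondr /=; apply: eq_bigr => p _.
  by case: ifPn => // /ws.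
have lx : ln x = 2 * ln (Num.sqrt x).
  by rewrite -{1}(@sqr_sqrtr _ x) ?ltW // lnXn ?sqrtr_gt0 // mulr_natl.
have s2 : 2 <= Num.sqrt x.
  by rewrite -[2](@ger0_norm R) // -sqrtr_sqr ler_wsqrtr // -natrX.
have ls : 0 < ln (Num.sqrt x) by rewrite ln_gt0; lra.
have sP p : p \in s -> [/\ prime p, Num.sqrt x <= p%:R & p%:R <= x].
  rewrite mem_filter => /andP[/andP[pp /andP[xp px]] _]; split=> //.
  apply: le_trans (ltW xp); have := @sqr_sqrtr _ x (ltW x0); nra.
have := @size_primes_le R x (Num.sqrt x) s ltac:(lra) (ltW x0)
  ltac:(by rewrite filter_uniq // iota_uniq) sP => hs.
apply: (@le_trans _ _ (\sum_(p <- s) 2 `^ rho)).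
  apply: (le_trans (ler_norm_sum _ _ _)); rewrite big_seq [leRHS]big_seq.
  apply: ler_sum => p; rewrite mem_filter => /andP[/andP[pp dp] _].
  apply: (le_trans (wt _ dp)); apply: ge0_ler_powR; rewrite ?nnegrE //; first lra.
  have := @tau_prime_mul p 1 pp isT; rewrite muln1 -[tau 1]/1%N => h.
  by rewrite ler_nat (leq_trans h).
rewrite big_const_seq count_predT iter_addr_0 -[_ *+ size s]mulr_natl.
have p2 : 0 <= 2 `^ rho :> R by exact: powR_ge0.
apply: (le_trans (ler_wpM2r p2 hs)); rewrite lx le_eqVlt; apply/orP; left; apply/eqP.
by field; rewrite gt_eqF.
Qed.
End prime_sum_bound.

Local Open Scope classical_set_scope.
Local Open Scope ring_scope.

(** * Riemann sums over convex sets *)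

Section integral_approximation.
Context d (T : measurableType d) (R : realType) (mu : {measure set T -> \bar R}).

(* The library integral of a nonnegative function is a supremum over the simple
   functions below it, hence monotone on all functions; a convex set need not be
   Borel, so this is what the sandwich below relies on. *)
Lemma le_integral_nonmeasurable (f g : T -> \bar R) :
  (forall x, (0 <= f x)%E) -> (forall x, (f x <= g x)%E) ->
  (\int[mu]_x f x <= \int[mu]_x g x)%E.
Proof.
move=> f0 fg; rewrite !ge0_integralTE //; last by move=> x; exact: le_trans (f0 x) (fg x).
apply: le_ereal_sup => _ [h hf <-]; exists h => // x; exact: le_trans (hf x) (fg x).
Qed.

Variables (C : finType) (Q : C -> set T) (v : R).
Hypotheses (mQ : forall c, measurable (Q c)) (muQ : forall c, mu (Q c) = v%:E).
Hypothesis Q_disj : forall c c' x, Q c x -> Q c' x -> c = c'.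

Definition step (a : C -> R) (x : T) : R := \sum_c a c * \1_(Q c) x.

Lemma step_in (a : C -> R) c x : Q c x -> step a x = a c.
Proof.
move=> Qx; rewrite /step (bigD1 c) //= big1 ?addr0; last first.
  move=> c' cc'; rewrite indicE memNset ?mulr0 // => Qx'.
  by rewrite (Q_disj Qx' Qx) eqxx in cc'.
by rewrite indicE mem_set ?mulr1.
Qed.

Lemma step_out (a : C -> R) x : (forall c, ~ Q c x) -> step a x = 0.
Proof. by move=> Qx; rewrite /step big1 // => c _; rewrite indicE memNset ?mulr0. Qed.

Lemma integral_step (a : C -> R) : (forall c, 0 <= a c) ->
  (\int[mu]_x (step a x)%:E = (\sum_c a c * v)%:E)%E.
Proof.
move=> a0.
under eq_integral do rewrite /step -sumEFin.
rewrite ge0_integral_sum //; last 2 first.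
- move=> c; apply/measurable_EFinP; apply: measurable_funM; first exact: measurable_cst.
  by apply: measurable_indic; exact: mQ.
- by move=> c x _; rewrite lee_fin mulr_ge0 // indicE.
rewrite -sumEFin; apply: eq_bigr => c _.
under eq_integral do rewrite EFinM.
rewrite ge0_integralZl //; last 2 first.
- by apply/measurable_EFinP; apply: measurable_indic; exact: mQ.
- by rewrite lee_fin.
by rewrite integral_indic // setIT muQ EFinM.
Qed.

Hypothesis v0 : 0 <= v.

(** F lies between the step functions with values max(s - e, 0) and s + e. The maximum keeps the
    lower one nonnegative, as the monotonicity lemma demands. *)
Lemma integral_ge0_step_approx (F : T -> R) (s e : C -> R) :
  (forall x, 0 <= F x) -> (forall c, 0 <= s c) -> (forall c, 0 <= e c) ->
  (forall c x, Q c x -> `|F x - s c| <= e c) ->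
  (forall x, (forall c, ~ Q c x) -> F x = 0) ->
  exists2 I : R, (\int[mu]_x (F x)%:E = I%:E)%E &
    `|I - \sum_c s c * v| <= \sum_c e c * v.
Proof.
move=> F0 s0 e0 Fs Fout.
have up : (\int[mu]_x (F x)%:E <= (\sum_c (s c + e c) * v)%:E)%E.
  rewrite -integral_step; last by move=> c; exact: addr_ge0.
  apply: le_integral_nonmeasurable => x; rewrite lee_fin //.
  have [[c Qx]|Qx] := pselect (exists c, Q c x).
    by rewrite (step_in _ Qx); have := Fs c x Qx; rewrite ler_norml; lra.
  by rewrite Fout ?step_out // => c Qc; apply: Qx; exists c.
have lo : ((\sum_c Num.max (s c - e c) 0 * v)%:E <= \int[mu]_x (F x)%:E)%E.
  rewrite -integral_step; last by move=> c; rewrite le_max lexx orbT.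
  apply: le_integral_nonmeasurable => x; rewrite lee_fin //.
    have [[c Qx]|Qx] := pselect (exists c, Q c x).
      by rewrite (step_in _ Qx) le_max lexx orbT.
    by rewrite step_out // => c Qc; apply: Qx; exists c.
  have [[c Qx]|Qx] := pselect (exists c, Q c x).
    rewrite (step_in _ Qx) ge_max F0 andbT; have := Fs c x Qx; rewrite ler_norml; lra.
  by rewrite Fout ?step_out // => c Qc; apply: Qx; exists c.
have fin : (\int[mu]_x (F x)%:E)%E \is a fin_num.
  rewrite fin_numE; apply/andP; split.
    by apply/eqP => h; rewrite h in lo.
  by apply/eqP => h; rewrite h in up.
exists (fine (\int[mu]_x (F x)%:E)%E); first by rewrite fineK.
move: up lo; rewrite -(fineK fin) !lee_fin; set I := fine _ => up lo.
have lo' : \sum_c (s c - e c) * v <= I.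
  apply: le_trans lo; apply: ler_sum => c _; apply: ler_wpM2r => //.
  by rewrite le_max lexx.
have E1 : \sum_c (s c - e c) * v = \sum_c s c * v - \sum_c e c * v.
  by rewrite -sumrB; apply: eq_bigr => c _; rewrite mulrBl.
have E2 : \sum_c (s c + e c) * v = \sum_c s c * v + \sum_c e c * v.
  by rewrite -big_split; apply: eq_bigr => c _; rewrite mulrDl.
move: lo' up; rewrite E1 E2 => lo' up.
by rewrite ler_distl lo' up.
Qed.

(** Positive and negative parts are treated separately. Taking the positive part is 1-Lipschitz, so
    each inherits the error e, whence the factor 2. *)
Lemma Rintegral_step_approx (D : set T) (F : T -> R) (s e : C -> R) :
  (forall c, 0 <= e c) ->
  (forall c x, Q c x -> `|(F \_ D) x - s c| <= e c) ->
  (forall x, (forall c, ~ Q c x) -> ~ D x) ->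
  `|Rintegral mu D F - \sum_c s c * v| <= 2 * \sum_c e c * v.
Proof.
move=> e0 Fs Fout; set G := F \_ D in Fs.
have Gout x : (forall c, ~ Q c x) -> G x = 0.
  by move=> /Fout Dx; rewrite /G patchE memNset.
have [Ip IpE hp] : exists2 I : R, (\int[mu]_x (Num.max (G x) 0)%:E = I%:E)%E &
    `|I - \sum_c Num.max (s c) 0 * v| <= \sum_c e c * v.
  apply: integral_ge0_step_approx => //; try by move=> *; rewrite le_max lexx orbT.
    move=> c x /Fs; rewrite !ler_norml.
    by have [?|?] := leP (G x) 0; have [?|?] := leP (s c) 0; have := e0 c; lra.
  by move=> x /Gout ->; rewrite maxxx.
have [In InE hn] : exists2 I : R, (\int[mu]_x (Num.max (- G x) 0)%:E = I%:E)%E &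
    `|I - \sum_c Num.max (- s c) 0 * v| <= \sum_c e c * v.
  apply: integral_ge0_step_approx => //; try by move=> *; rewrite le_max lexx orbT.
    move=> c x /Fs; rewrite !ler_norml.
    by have [?|?] := leP (- G x) 0; have [?|?] := leP (- s c) 0; have := e0 c; lra.
  by move=> x /Gout ->; rewrite oppr0 maxxx.
have -> : Rintegral mu D F = Ip - In.
  rewrite /Rintegral integral_mkcond integralE.
  have -> : ((fun x => (F x)%:E) \_ D) = (fun x => (G x)%:E).
    by apply/funext => x; rewrite /G !patchE; case: ifP.
  have -> : (\int[mu]_x ((fun x => (G x)%:E) ^\+ x) = Ip%:E)%E.
    by rewrite -IpE; apply: eq_integral => x _; rewrite funeposE EFin_max.
  have -> : (\int[mu]_x ((fun x => (G x)%:E) ^\- x) = In%:E)%E.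
    by rewrite -InE; apply: eq_integral => x _; rewrite funenegE EFin_max.
  by [].
have -> : \sum_c s c * v = \sum_c Num.max (s c) 0 * v - \sum_c Num.max (- s c) 0 * v.
  rewrite -sumrB; apply: eq_bigr => c _; rewrite -mulrBl; congr (_ * _).
  by have [?|?] := leP (s c) 0; have [?|?] := leP (- s c) 0; lra.
move: hp hn; rewrite !ler_norml; lra.
Qed.
End integral_approximation.

Section boxes.
Variable R : realType.

(** Bounds indexed by nat make dropping the first coordinate a composition with [S] in the induction
    on d. Half-open sides make the cells of a grid disjoint. *)
Definition box (d : nat) (a b : nat -> R) : set (d.-tuple (measurableTypeR R)) :=
  [set u | forall i : 'I_d, a i <= tnth u i < b i].

Lemma measurable_box (d : nat) (a b : nat -> R) : measurable (@box d a b).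
Proof.
have -> : @box d a b = \big[setI/setT]_(i <- index_enum 'I_d)
    ((fun u : d.-tuple (measurableTypeR R) => tnth u i) @^-1` `[a i, b i[%classic).
  apply/seteqP; split=> u.
    move=> ub; rewrite -bigcap_seq => i _ /=; rewrite in_itv /=; exact: ub.
  by rewrite -bigcap_seq => ub i; have /= := ub i (mem_index_enum _); rewrite in_itv.
apply: bigsetI_measurable => i _; rewrite -[X in measurable X]setTI.
by apply: (@measurable_tnth _ _ d i) => //; exact: measurable_itv.
Qed.

Lemma lebesgue_tuple_box (d : nat) (a b : nat -> R) : (forall i, a i <= b i) ->
  lebesgue_tuple R d (@box d a b) = (\prod_(i < d) (b i - a i))%:E.
Proof.
elim: d a b => [|d IH] a b ab.
  by rewrite big_ord0 /= diracE mem_set //; case.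
rewrite big_ord_recl /= /lebesgue_cons /pushforward.
have -> : @tuple_cons R d @^-1` (@box d.+1 a b) =
    `[a 0%N, b 0%N[%classic `*` @box d (a \o S) (b \o S).
  apply/seteqP; split=> -[t u].
    move=> tu; split=> /=; first by have := tu ord0; rewrite in_itv /= /tuple_cons (tnth_nth 0).
    move=> i; have := tu (lift ord0 i); rewrite /tuple_cons /= !(tnth_nth 0) /= .
    by rewrite /bump leq0n add1n.
  case=> /=; rewrite in_itv /= => ht hu i.
  have [->|[j ->]] : i = ord0 \/ exists j, i = lift ord0 j.
  - case: (unliftP ord0 i) => [j ->|->]; [by right; exists j|by left].
  - by rewrite /tuple_cons (tnth_nth 0).
  have := hu j; rewrite /tuple_cons !(tnth_nth 0) /=.
  by rewrite /bump leq0n add1n.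
rewrite product_measure1E; [|exact: measurable_itv|exact: measurable_box].
rewrite IH; last by move=> i; exact: ab.
rewrite EFinM; congr (_ * _)%E.
apply: (etrans (@lebesgue_measure_itv R `[a 0%N, b 0%N[)); rewrite /= lte_fin.
case: ltP => // ba; have -> : a 0%N = b 0%N by apply/eqP; rewrite eq_le ab ba.
by rewrite subrr.
Qed.
End boxes.

(** * Convex sets, orthants and the hyperplane of coordinate sum 1 *)

Section convex_geometry.
Variable R : realType.

Lemma convex_set_comb (n : nat) (T : set 'rV[R]_n) (x y : 'rV[R]_n) (l : R) :
  convex_set T -> T x -> T y -> 0 <= l <= 1 -> T (l *: x + (1 - l) *: y).
Proof.
move=> cT Tx Ty /andP[l0 l1].
by have := cT x y (Itv01 l0 l1); rewrite !inE => /(_ Tx Ty); exact.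
Qed.

Variable d : nat.
Let wi (i : 'I_d) : 'I_d.+1 := widen_ord (leqnSn d) i.

(** The last coordinate is left out, since on the hyperplane it is determined by the others. *)
Definition in_orthant (s : 'I_d -> bool) (y t : 'rV[R]_d.+1) :=
  forall i, if s i then y 0 (wi i) < t 0 (wi i) else t 0 (wi i) < y 0 (wi i).

(* Coordinates are matched one at a time, by joining two points lying on
   opposite sides. *)
Lemma convex_orthants (T : set 'rV[R]_d.+1) (y : 'rV[R]_d.+1) : convex_set T ->
  (forall s : 'I_d -> bool, exists2 t, T t & in_orthant s y t) ->
  exists2 t, T t & forall i : 'I_d, t 0 (wi i) = y 0 (wi i).
Proof.
move=> cT H.
suff /(_ d (leqnn d) (fun=> true)) [t Tt tP] : forall j, (j <= d)%N -> forall s : 'I_d -> bool,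
    exists2 t, T t & forall i : 'I_d, if (i < j)%N then t 0 (wi i) = y 0 (wi i) else
      is_true (if s i then y 0 (wi i) < t 0 (wi i) else t 0 (wi i) < y 0 (wi i)).
  by exists t => // i; have := tP i; rewrite ltn_ord.
elim=> [_ s|j IH jd s]; first by have [t Tt tP] := H s; exists t.
have [t1 T1 P1] := IH (ltnW jd) (fun i => (i == Ordinal jd) || s i).
have [t2 T2 P2] := IH (ltnW jd) (fun i => (i != Ordinal jd) && s i).
have := P1 (Ordinal jd); have := P2 (Ordinal jd); rewrite /= ltnn eqxx /=.
set yj := y 0 _; set a := t2 0 _; set b := t1 0 _ => ay yb.
have ba : 0 < b - a by lra.
pose l := (yj - a) / (b - a).
have l01 : 0 < l < 1.
  by apply/andP; split; rewrite /l; [apply: divr_gt0; lra|rewrite ltr_pdivrMr // mul1r; lra].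
exists (l *: t1 + (1 - l) *: t2).
  by apply: convex_set_comb => //; case/andP: l01 => *; rewrite !ltW.
move=> i; rewrite !mxE ltnS leq_eqVlt.
have [ij|ij] := eqVneq (i : nat) j.
  have -> : i = Ordinal jd by exact: val_inj.
  rewrite -/a -/b -/yj /l /=; field; lra.
have := P1 i; have := P2 i; have iJ : (i == Ordinal jd) = false.
  by apply: contraNF ij => /eqP ->.
rewrite iJ /=; have [_|_] := ltnP i j.
  by move=> -> ->; ring.
by case: (s i) => /= h1 h2; nra.
Qed.

Lemma simplex_point_wi (u : d.-tuple R) (i : 'I_d) :
  @simplex_point R d.+1 u 0 (wi i) = tnth u i.
Proof. by rewrite mxE (tnth_nth (1 - \sum_(t <- u) t)). Qed.

Lemma simplex_point_last (u : d.-tuple R) :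
  @simplex_point R d.+1 u 0 ord_max = 1 - \sum_(i < d) tnth u i.
Proof. by rewrite mxE /= nth_default ?size_tuple // big_tuple. Qed.

Lemma sum_simplex_point (u : d.-tuple R) :
  \sum_i @simplex_point R d.+1 u 0 i = 1.
Proof.
rewrite big_ord_recr /= simplex_point_last.
under eq_bigr do rewrite simplex_point_wi.
by rewrite addrC subrK.
Qed.

Lemma eq_simplex_point (t t' : 'rV[R]_d.+1) : \sum_i t 0 i = 1 -> \sum_i t' 0 i = 1 ->
  (forall i, t 0 (wi i) = t' 0 (wi i)) -> t = t'.
Proof.
move=> st st' tt'; apply/rowP => i; have [j ->|->] := unliftP ord_max i.
  by have -> : lift ord_max j = wi j by apply: val_inj; rewrite /= /bump leqNgt ltn_ord.
move: st st'; rewrite !big_ord_recr /= (eq_bigr (fun j => t' 0 (wi j))) => [<- /addrI ->//|j _].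
exact: tt'.
Qed.

Lemma prod_dist_le (I : Type) (r : seq I) (F G : I -> R) :
  (forall i, 0 <= F i <= 1) -> (forall i, 0 <= G i <= 1) ->
  `|\prod_(i <- r) F i - \prod_(i <- r) G i| <= \sum_(i <- r) `|F i - G i|.
Proof.
move=> F01 G01; elim: r => [|i r IH]; first by rewrite !big_nil subrr normr0.
rewrite !big_cons.
have -> : F i * \prod_(j <- r) F j - G i * \prod_(j <- r) G j =
  (F i - G i) * \prod_(j <- r) F j + G i * (\prod_(j <- r) F j - \prod_(j <- r) G j) by ring.
apply: (le_trans (ler_normD _ _)); rewrite !normrM; apply: lerD.
  rewrite ler_piMr // ger0_norm; first by apply: prodr_ile1 => j _; exact: F01.
  by apply: prodr_ge0 => j _; case/andP: (F01 j).
by have /andP[? ?] := G01 i; rewrite (le_trans _ IH) // ler_piMl // ger0_norm.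
Qed.
End convex_geometry.

(** * Grid cells meeting the boundary of a convex set *)

Section grid.
Variables (R : realType) (d m : nat).
Hypothesis m0 : (0 < m)%N.
Local Notation index := {ffun 'I_d -> 'I_m}.
Let wi (i : 'I_d) : 'I_d.+1 := widen_ord (leqnSn d) i.

(** Adapts an index to the nat-indexed bounds of [box]; the default 0 beyond d is never read. *)
Definition index_nat (I : index) (i : nat) : nat :=
  if insub i is Some j then I j : nat else 0%N.

Definition cell (I : index) : set (d.-tuple (measurableTypeR R)) :=
  @box R d (fun i => (index_nat I i)%:R / m%:R) (fun i => (index_nat I i).+1%:R / m%:R).

Let mR : 0 < m%:R :> R. Proof. by rewrite ltr0n. Qed.

Lemma cellP (I : index) (u : d.-tuple R) :
  cell I u <-> forall i : 'I_d, (I i)%:R / m%:R <= tnth u i < (I i).+1%:R / m%:R.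
Proof.
by split=> h i; have := h i; rewrite /index_nat valK.
Qed.

Lemma lebesgue_cell (I : index) : lebesgue_tuple R d (cell I) = (m%:R ^- d)%:E.
Proof.
rewrite lebesgue_tuple_box; last first.
  by move=> i; rewrite ler_pM2r ?invr_gt0 // ler_nat.
congr EFin; rewrite (eq_bigr (fun=> m%:R^-1)); last first.
  by move=> i _; rewrite -mulrBl -natrB ?leqnSn // subSnn mul1r.
by rewrite prodr_const card_ord exprVn.
Qed.

Lemma cell_disj (I J : index) (u : d.-tuple R) : cell I u -> cell J u -> I = J.
Proof.
move=> /cellP uI /cellP uJ; apply/ffunP => i; apply: val_inj => /=.
have /andP[a1 a2] := uI i; have /andP[b1 b2] := uJ i.
have := le_lt_trans a1 b2; have := le_lt_trans b1 a2.
rewrite !ltr_pM2r ?invr_gt0 // !ltr_nat; lia.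
Qed.

Lemma cell_cover (u : d.-tuple R) : (forall i, 0 <= tnth u i < 1) -> exists I, cell I u.
Proof.
move=> u01.
have h i : (Num.trunc (tnth u i * m%:R) < m)%N.
  have /andP[u0 u1] := u01 i; rewrite truncn_lt_nat ?mulr_ge0 // ?ltW //.
  by rewrite -{2}[m%:R]mul1r ltr_pM2r.
exists [ffun i => Ordinal (h i)]; apply/cellP => i; rewrite ffunE /=.
have /andP[u0 u1] := u01 i; rewrite ler_pdivrMr // ltr_pdivlMr //.
by apply: truncn_itv; rewrite mulr_ge0 // ltW.
Qed.

Lemma cell_dist (I : index) (u v : d.-tuple R) (i : 'I_d) : cell I u -> cell I v ->
  `|tnth u i - tnth v i| <= m%:R^-1.
Proof.
move=> /cellP/(_ i)/andP[a1 a2] /cellP/(_ i)/andP[b1 b2].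
have E : (I i).+1%:R / m%:R = (I i)%:R / m%:R + m%:R^-1 :> R by rewrite -natr1 mulrDl mul1r.
rewrite E in a2 b2; rewrite ler_norml; apply/andP; split; lra.
Qed.

Lemma simplex_point_dist (I : index) (u v : d.-tuple R) (i : 'I_d.+1) : (0 < d)%N ->
  cell I u -> cell I v ->
  `|@simplex_point R d.+1 u 0 i - @simplex_point R d.+1 v 0 i| <= d%:R / m%:R.
Proof.
move=> d0 uI vI; have [j ->|->] := unliftP ord_max i.
  have -> : lift ord_max j = wi j by apply: val_inj; rewrite /= /bump leqNgt ltn_ord.
  rewrite !simplex_point_wi; apply: (le_trans (cell_dist _ uI vI)).
  by rewrite ler_peMl ?invr_ge0 // ler1n.
rewrite !simplex_point_last.
have -> (a b : R) : 1 - a - (1 - b) = b - a by ring.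
rewrite -sumrB.
apply: (le_trans (ler_norm_sum _ _ _)).
apply: (@le_trans _ _ (\sum_(j < d) m%:R^-1)).
  by apply: ler_sum => j _; exact: cell_dist vI uI.
by rewrite sumr_const card_ord mulr_natl.
Qed.

Variable T : set 'rV[R]_d.+1.
Hypothesis cT : convex_set T.
Hypothesis T_sum : forall u, T u -> \sum_i u 0 i = 1.
Local Notation T' := (fun u : d.-tuple R => T (@simplex_point R d.+1 u)).

Definition boundary_cell (I : index) : Prop :=
  (exists2 u, cell I u & T' u) /\ (exists2 u, cell I u & ~ T' u).

(** J is reached from I along a diagonal. One whole step in every coordinate already places all of J
    in the open orthant of direction s at any point of I. *)
Definition ahead (s : 'I_d -> bool) (I J : index) : Prop :=
  exists2 j, (0 < j)%N &
    forall i, if s i then (J i = I i + j :> nat)%N else (I i = J i + j :> nat)%N.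

Definition blocked (s : 'I_d -> bool) (I : index) : Prop :=
  forall J, ahead s I J -> forall u, cell J u -> ~ T' u.

(* A point outside [T] has an open orthant missing [T], and that orthant contains
   the cells ahead on the corresponding diagonal. *)
Lemma boundary_cell_blocked (I : index) : boundary_cell I ->
  exists s : {ffun 'I_d -> bool}, blocked s I.
Proof.
move=> [_ [y /cellP yI nTy]]; apply: contrapT => nex; apply: nTy.
have [|t Tt ty] := @convex_orthants R d T (@simplex_point R d.+1 y) cT.
  move=> s; apply: contrapT => nt; apply: nex; exists [ffun i => s i].
  move=> J [j j0 JP] u /cellP uJ Tu; apply: nt; exists (@simplex_point R d.+1 u) => // i.
  have := JP i; rewrite !simplex_point_wi ffunE.
  have /andP[y1 y2] := yI i; have /andP[u1 u2] := uJ i.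
  case: (s i) => e.
    apply: lt_le_trans y2 _; apply: le_trans u1; rewrite ler_pM2r ?invr_gt0 // ler_nat; lia.
  apply: lt_le_trans u2 _; apply: le_trans y1; rewrite ler_pM2r ?invr_gt0 // ler_nat; lia.
have -> // : @simplex_point R d.+1 y = t.
by apply: eq_simplex_point; rewrite ?sum_simplex_point ?T_sum.
Qed.

End grid.

Section boundary_count.
Variables (R : realType) (d m : nat).
Hypothesis m0 : (0 < m)%N.
Local Notation index := {ffun 'I_d.+1 -> 'I_m}.
Variable T : set 'rV[R]_d.+2.
Hypothesis cT : convex_set T.
Hypothesis T_sum : forall u, T u -> \sum_i u 0 i = 1.

(** A label for the diagonal of direction s through I: moving along it preserves the difference with
    coordinate 0 where the signs agree and the sum where they differ. Adding m keeps the difference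
    a natural number, and all values stay below 2m+1. *)
Definition diagonal (s : 'I_d.+1 -> bool) (I : index) : {ffun 'I_d -> 'I_(2 * m).+1} :=
  [ffun i => inord (if s (lift ord0 i) == s ord0
     then I (lift ord0 i) + m - I ord0 else I (lift ord0 i) + I ord0)%N].

Lemma diagonal_ahead (s : 'I_d.+1 -> bool) (I J : index) :
  diagonal s I = diagonal s J ->
  (if s ord0 then I ord0 < J ord0 else J ord0 < I ord0)%N -> ahead s I J.
Proof.
move=> IJ lt0; exists (if s ord0 then J ord0 - I ord0 else I ord0 - J ord0)%N.
  by move: lt0; case: (s ord0); lia.
move=> i; have [j ->|->] := unliftP ord0 i; last by move: lt0; case: (s ord0); lia.
have := congr1 (fun F : {ffun 'I_d -> 'I_(2 * m).+1} => val (F j)) IJ; rewrite !ffunE /=.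
have := ltn_ord (I (lift ord0 j)); have := ltn_ord (J (lift ord0 j)).
have := ltn_ord (I ord0); have := ltn_ord (J ord0).
move: (I (lift ord0 j) : nat) (J (lift ord0 j) : nat) (I ord0 : nat) (J ord0 : nat) lt0.
move=> a b c e lt0 h1 h2 h3 h4.
by case: (s (lift ord0 j)) lt0; case: (s ord0) => /= lt0; rewrite !inordK; lia.
Qed.

(** Of two distinct cells on one diagonal, one is ahead of the other; if the one behind is blocked,
    the one ahead misses T and is no boundary cell. Hence each diagonal of direction s holds at most
    one boundary cell blocked in that direction, and there are only (2m+1)^d such diagonals. *)
Lemma card_boundary_cells :
  (#|[pred I : index | `[< boundary_cell T I >]]| <= 2 ^ d.+1 * (3 * m) ^ d)%N.
Proof.
pose A (s : {ffun 'I_d.+1 -> bool}) :=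
  [pred I : index | `[< boundary_cell T I >] && `[< blocked T s I >]].
have cardA s : (#|A s| <= (3 * m) ^ d)%N.
  apply: (@leq_trans ((2 * m).+1 ^ d)); last first.
    by case: (d) => [//|e]; rewrite leq_exp2r //; lia.
  rewrite -[X in (_ <= X ^ _)%N]card_ord -[X in (_ <= _ ^ X)%N]card_ord -card_ffun.
  rewrite -(@card_in_image _ _ (diagonal s)); first exact: max_card.
  have one (I J : index) : I \in A s -> J \in A s -> diagonal s I = diagonal s J ->
      ~~ (if s ord0 then I ord0 < J ord0 else J ord0 < I ord0)%N.
    move=> /andP[_ /asboolP bI] /andP[/asboolP[[u uJ Tu] _] _] IJ; apply/negP => lt0.
    exact: (bI J (diagonal_ahead IJ lt0) u uJ Tu).
  move=> I J IA JA IJ.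
  have I0 : I ord0 = J ord0 :> nat.
    have := one _ _ IA JA IJ; have := one _ _ JA IA (esym IJ).
    by case: (s ord0); rewrite -!leqNgt => h1 h2; apply/eqP; rewrite eqn_leq h1 h2.
  apply/ffunP => i; apply: val_inj; have [j ->|-> //] := unliftP ord0 i.
  have := congr1 (fun F : {ffun 'I_d -> 'I_(2 * m).+1} => val (F j)) IJ; rewrite !ffunE /=.
  have := ltn_ord (I (lift ord0 j)); have := ltn_ord (J (lift ord0 j)).
  have := ltn_ord (I ord0); have := ltn_ord (J ord0).
  move: (I (lift ord0 j) : nat) (J (lift ord0 j) : nat) (I ord0 : nat) (J ord0 : nat) I0.
  move=> a b c e -> h1 h2 h3 h4.
  by case: ifP => _; rewrite !inordK; lia.
apply: (@leq_trans (\sum_(s : {ffun 'I_d.+1 -> bool}) #|A s|)); last first.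
  apply: (@leq_trans (\sum_(s : {ffun 'I_d.+1 -> bool}) (3 * m) ^ d)).
    by apply: leq_sum => s _; exact: cardA.
  by rewrite sum_nat_const card_ffun card_bool card_ord.
under [X in (_ <= X)%N]eq_bigr do rewrite -sum1_card big_mkcond.
rewrite exchange_big /= -sum1_card big_mkcond /=; apply: leq_sum => I _.
case: ifP => //; rewrite inE => bI.
have [s bs] := boundary_cell_blocked m0 cT T_sum bI.
have Is : I \in A s by apply/andP; split; apply/asboolP.
by rewrite (bigD1 s) //= Is.
Qed.
End boundary_count.

(** * Riemann sums on the ordered simplex *)

Section riemann_sum.
Variables (R : realType) (d m : nat) (nu : R).
Hypotheses (m0 : (0 < m)%N) (nu0 : 0 < nu).
Local Notation index := {ffun 'I_d.+1 -> 'I_m}.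
Local Notation k := d.+2.

Definition ordered_simplex : set 'rV[R]_k :=
  [set u | [/\ \sum_i u 0 i = 1, forall i, nu <= u 0 i
      & forall i j : 'I_k, (i <= j)%N -> u 0 i <= u 0 j]].

Variables (tagged : pred index) (tag : index -> d.+1.-tuple R).
Hypothesis tag_cell : forall I, tagged I -> cell I (tag I).
Hypothesis taggedP : forall I : index,
  (forall u : d.+1.-tuple R, cell I u -> ordered_simplex (@simplex_point R k u)) -> tagged I.

Variables (T : set 'rV[R]_k) (f : 'rV[R]_k -> R).
Hypotheses (cT : convex_set T) (T_simplex : T `<=` ordered_simplex).
Hypothesis f_le1 : forall u, T u -> `|f u| <= 1.
Hypothesis f_lip : forall u v, T u -> T v -> `|f u - f v| <= euclidean_dist u v.

Let g (u : 'rV[R]_k) := f u / \prod_i u 0 i.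

Lemma simplex_coord u i : ordered_simplex u -> 0 <= u 0 i <= 1.
Proof.
move=> [su nuu _]; have u0 j : 0 <= u 0 j by rewrite (le_trans (ltW nu0)).
by rewrite u0 -su (bigD1 i) //= lerDl sumr_ge0.
Qed.

Lemma simplex_prod_ge u : ordered_simplex u -> nu ^+ k <= \prod_i u 0 i.
Proof.
move=> [_ nuu _]; rewrite -[k in nu ^+ k]card_ord -prodr_const.
by apply: ler_prod => i _; rewrite ltW //=.
Qed.

Lemma simplex_prod_inv_le u : ordered_simplex u -> 0 <= (\prod_i u 0 i)^-1 <= nu ^- k.
Proof.
move=> us; have p0 : 0 < nu ^+ k by rewrite exprn_gt0.
have := simplex_prod_ge us => pu.
by rewrite invr_ge0 (le_trans (ltW p0)) //= lef_pV2 ?posrE // (lt_le_trans p0).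
Qed.

Lemma integrand_le u : T u -> `|g u| <= nu ^- k.
Proof.
move=> Tu; have /andP[h1 h2] := simplex_prod_inv_le (T_simplex Tu).
rewrite /g normrM (ger0_norm h1); apply: le_trans h2.
by rewrite ler_piMl // f_le1.
Qed.

Lemma integrand_dist (u v : 'rV[R]_k) (h : R) : 0 <= h -> (forall i, `|u 0 i - v 0 i| <= h) -> T u -> T v ->
  `|g u - g v| <= 2 * (k%:R * h * (nu ^- k * nu ^- k)).
Proof.
move=> h0 uv Tu Tv; have us := T_simplex Tu; have vs := T_simplex Tv.
set N := nu ^- k; have N1 : 1 <= N.
  rewrite /N; have p0 : 0 < nu ^+ k by rewrite exprn_gt0.
  rewrite invf_ge1 // exprn_ile1 ?(ltW nu0) //; case: us => _ /(_ ord0) nuu _.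
  by apply: (le_trans nuu); have /andP[] := simplex_coord ord0 (T_simplex Tu).
have /andP[pu0 puN] := simplex_prod_inv_le us; have /andP[pv0 pvN] := simplex_prod_inv_le vs.
have kh : 0 <= k%:R * h by rewrite mulr_ge0.
have fuv : `|f u - f v| <= k%:R * h.
  apply: (le_trans (f_lip Tu Tv)); rewrite /euclidean_dist.
  rewrite -[leRHS]ger0_norm // -sqrtr_sqr ler_wsqrtr //.
  apply: (@le_trans _ _ (\sum_(i < k) h ^+ 2)).
    by apply: ler_sum => i _; rewrite -real_normK ?num_real // lerXn2r ?nnegrE.
  rewrite sumr_const card_ord -[_ *+ k]mulr_natl exprMn ler_wpM2r ?sqr_ge0 //.
  by rewrite expr2 ler_peMl // ler1n.
have puv : `|\prod_i u 0 i - \prod_i v 0 i| <= k%:R * h.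
  apply: (le_trans (prod_dist_le _ _ _)).
  - by move=> i; exact: simplex_coord.
  - by move=> i; exact: simplex_coord.
  apply: (@le_trans _ _ (\sum_(i < k) h)); first exact: ler_sum.
  by rewrite sumr_const card_ord mulr_natl.
have pu : 0 < \prod_i u 0 i by apply: lt_le_trans (simplex_prod_ge us); rewrite exprn_gt0.
have pv : 0 < \prod_i v 0 i by apply: lt_le_trans (simplex_prod_ge vs); rewrite exprn_gt0.
rewrite /g; set p := \prod_i u 0 i in pu0 puN puv pu *.
set q := \prod_i v 0 i in pv0 pvN puv pv *.
have -> : f u / p - f v / q = (f u - f v) / p + f v * (q - p) * (p^-1 * q^-1).
  by field; rewrite !gt_eqF.
have -> (X : R) : 2 * X = X + X by ring.
apply: (le_trans (ler_normD _ _)); apply: lerD.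
  rewrite normrM (ger0_norm pu0); apply: ler_pM => //; apply: (le_trans puN).
  by rewrite ler_peMr // (le_trans ler01).
rewrite !normrM (ger0_norm pu0) (ger0_norm pv0) distrC; apply: ler_pM.
- by rewrite mulr_ge0.
- by rewrite mulr_ge0.
- by apply: le_trans puv; rewrite ler_piMl // f_le1.
- exact: ler_pM.
Qed.

(** A cell inside T costs the oscillation of the integrand, O(1/m), and a cell missing T costs
    nothing. A boundary cell costs up to 2 nu^-k, but there are O(m^d) of them, each of volume
    m^-(d+1). *)
Lemma riemann_sum_approx :
  `|hyperplane_integral T g -
    \sum_(I : index | tagged I) m%:R ^- d.+1 * (\prod_i @simplex_point R k (tag I) 0 i)^-1 *
       patch (fun=> 0) T f (@simplex_point R k (tag I))| <=
  (4 * (k%:R * d.+1%:R * (nu ^- k * nu ^- k)) + 4 * nu ^- k * (2 ^+ d.+1 * 3 ^+ d)) / m%:R.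
Proof.
have mR : 0 < m%:R :> R by rewrite ltr0n.
pose sp (u : d.+1.-tuple R) := @simplex_point R k u.
pose s (I : index) := if tagged I then patch (fun=> 0) T f (sp (tag I)) *
   (\prod_i sp (tag I) 0 i)^-1 else 0.
pose om := 2 * (k%:R * (d.+1%:R / m%:R) * (nu ^- k * nu ^- k)).
pose N := nu ^- k; have N0 : 0 <= N by rewrite invr_ge0 exprn_ge0 // ltW.
have om0 : 0 <= om by rewrite !mulr_ge0 // invr_ge0.
pose bd (I : index) := `[< boundary_cell T I >].
pose e (I : index) := if bd I then 2 * N else om.
have sN I : `|s I| <= N.
  rewrite /s; case: ifP => [tI|_]; last by rewrite normr0.
  rewrite patchE; case: ifPn => [|_]; last by rewrite mul0r normr0.
  by rewrite inE => Ts; exact: integrand_le.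
set v := m%:R ^- d.+1 : R; have v0 : 0 <= v by rewrite invr_ge0 exprn_ge0 // ltW.
have -> : \sum_(I : index | tagged I) v * (\prod_i sp (tag I) 0 i)^-1 *
       patch (fun=> 0) T f (sp (tag I)) = \sum_(I : index) s I * v.
  rewrite big_mkcond; apply: eq_bigr => I _; rewrite /s; case: ifP => _; last by rewrite mul0r.
  by ring.
have := @Rintegral_step_approx _ _ R (lebesgue_tuple R d.+1) _ (@cell R d.+1 m) v
  (fun I => @measurable_box R d.+1 _ _) (@lebesgue_cell R d.+1 m m0)
  (@cell_disj R d.+1 m m0) v0 (sp @^-1` T) (fun u => g (sp u)) s e.
move=> H; apply: (le_trans (H _ _ _)) => {H}.
- by move=> I; rewrite /e; case: ifP => // _; rewrite mulr_ge0.
- move=> I u uI; rewrite /e; case: ifPn => [_|/asboolPn nb].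
    have -> : 2 * N = N + N by ring.
    apply: (le_trans (ler_normB _ _)); apply: lerD => //.
    rewrite patchE; case: ifPn => [|_]; last by rewrite normr0.
    by rewrite inE => Tu; exact: integrand_le.
  rewrite patchE; case: ifPn => [|/negP]; rewrite inE /= => Tu.
    have allT w : cell I w -> T (sp w).
      by move=> wI; apply: contrapT => nT; apply: nb; split; [exists u|exists w].
    have tI : tagged I by apply: taggedP => w /allT /T_simplex.
    have Tt : T (sp (tag I)) by apply: allT; exact: tag_cell.
    rewrite /s tI patchE mem_set //; apply: integrand_dist => //.
    by move=> i; exact: (simplex_point_dist i (ltn0Sn d) uI (tag_cell tI)).
  rewrite sub0r normrN /s; case: ifP => [tI|_]; last by rewrite normr0.
  rewrite patchE; case: ifPn => [|_]; last by rewrite mul0r normr0.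
  rewrite inE => Tt; exfalso; apply: nb; split; first by exists (tag I) => //; exact: tag_cell.
  by exists u.
(* A coordinate equal to 1 would leave nothing for the last one, which is at least nu > 0; so T lies
   over the half-open cube covered by the cells. *)
- move=> u nu' /= Tu; have [I uI] : exists I, @cell R d.+1 m I u; last exact: nu' uI.
  apply: (cell_cover m0) => i.
  have us := T_simplex Tu; have := simplex_coord (widen_ord (leqnSn d.+1) i) us.
  rewrite simplex_point_wi => /andP[-> u1] /=; rewrite lt_neqAle u1 andbT.
  apply/eqP => u1'; case: us => su nuu _.
  move: su; rewrite (bigD1 (widen_ord (leqnSn d.+1) i)) //= simplex_point_wi u1'.
  rewrite (bigD1 ord_max) /=; last by rewrite -val_eqE /= gtn_eqF.
  have : 0 <= \sum_(j < k | (j != widen_ord (leqnSn d.+1) i) && (j != ord_max)) sp u 0 j.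
    by apply: sumr_ge0 => j _; rewrite (le_trans (ltW nu0)).
  have := nuu ord_max; move: nu0; rewrite -/(sp u); set a := \sum_(_ < _ | _) _; lra.
have cardv : #|{: index}|%:R * v = 1.
  by rewrite card_ffun !card_ord natrX mulfV // expf_neq0 // gt_eqF.
have eb : \sum_I e I * v <= om + 2 * N * (2 ^+ d.+1 * 3 ^+ d) / m%:R.
  apply: (@le_trans _ _ (\sum_(I : index) (om * v + (bd I)%:R * (2 * N * v)))).
    apply: ler_sum => I _; rewrite /e; case: ifP => _; last by rewrite mul0r addr0.
    by rewrite mul1r lerDr mulr_ge0.
  rewrite big_split /= sumr_const -[_ *+ _]mulr_natl mulrCA cardv mulr1 lerD2l.
  rewrite -mulr_suml -natr_sum.
  have -> : (\sum_I bd I)%N = #|[pred I : index | bd I]|.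
    by rewrite -sum1_card [RHS]big_mkcond; apply: eq_bigr => I _; rewrite inE; case: (bd I).
  have := card_boundary_cells m0 cT (fun u Tu => let: And3 h _ _ := T_simplex Tu in h).
  rewrite -(ler_nat R) natrM !natrX natrM exprMn => cb.
  have N2v : 0 <= 2 * N * v by rewrite !mulr_ge0.
  apply: (le_trans (ler_wpM2r N2v cb)); rewrite le_eqVlt; apply/orP; left; apply/eqP.
  rewrite /v [m%:R ^+ d.+1]exprS; field.
  by rewrite expf_neq0 gt_eqF.
apply: (le_trans (ler_wpM2l _ eb)) => //; rewrite le_eqVlt; apply/orP; left; apply/eqP.
rewrite /om -/N; field; by rewrite gt_eqF.
Qed.
End riemann_sum.

(** * A model sequence *)

Section prime_products.

Lemma logn_prod_primes (s : seq nat) (p : nat) : prime p -> all prime s ->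
  logn p (\prod_(q <- s) q)%N = count_mem p s.
Proof.
move=> pp; elim: s => [_|q s IH /= /andP[pq ps]]; first by rewrite big_nil logn1.
have s0 : (0 < \prod_(r <- s) r)%N.
  by rewrite big_seq; apply: prodn_cond_gt0 => r /(allP ps)/prime_gt0.
rewrite big_cons (lognM p (prime_gt0 pq) s0) (IH ps) logn_prime //; congr (_ + _)%N.
by rewrite eq_sym.
Qed.

Lemma sorted_primes_eq (s t : seq nat) : all prime s -> all prime t ->
  sorted leq s -> sorted leq t -> (\prod_(q <- s) q = \prod_(q <- t) q)%N -> s = t.
Proof.
move=> ps pt ss st E; apply: (sorted_eq leq_trans anti_leq) => //.
apply/allP => p _ /=; have [pp|np] := boolP (prime p).
  by rewrite -!logn_prod_primes // E.
have c0 r : all prime r -> count_mem p r = 0%N.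
  by move=> pr; apply/count_memPn/negP => /(allP pr); apply/negP.
by rewrite !c0.
Qed.

(** Unique factorization. Lists are compared because k and l may differ; equality of the lists then
    also gives k = l. *)
Lemma prime_functions_eq (k l : nat) (p : 'I_k -> nat) (q : 'I_l -> nat) :
  (forall i, prime (p i)) -> (forall i, prime (q i)) ->
  (forall i j : 'I_k, (i <= j)%N -> (p i <= p j)%N) ->
  (forall i j : 'I_l, (i <= j)%N -> (q i <= q j)%N) ->
  (\prod_(i < k) p i = \prod_(i < l) q i)%N ->
  [seq p i | i <- enum 'I_k] = [seq q i | i <- enum 'I_l].
Proof.
have sortedP n (r : 'I_n -> nat) : (forall i j : 'I_n, (i <= j)%N -> (r i <= r j)%N) ->
    sorted leq [seq r i | i <- enum 'I_n].
  move=> rm; apply: (@homo_sorted _ _ (fun i : 'I_n => r i) (fun i j : 'I_n => (i <= j)%N)) => //.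
  by rewrite -(@sorted_map _ _ (@nat_of_ord n) leq) val_enum_ord iota_sorted.
move=> pp pq pm qm E; apply: sorted_primes_eq.
- by apply/allP => _ /mapP[i _ ->].
- by apply/allP => _ /mapP[i _ ->].
- exact: sortedP.
- exact: sortedP.
rewrite !big_map; move: E; rewrite ![index_enum _]unlock; exact.
Qed.

Lemma prime_prodF (k : nat) (p : 'I_k.+2 -> nat) :
  (forall i, prime (p i)) -> prime (\prod_(i < k.+2) p i)%N = false.
Proof.
move=> pp; apply/negP => pr; have p0 := pp ord0; have p1 := pp (lift ord0 ord0).
move: pr; rewrite !big_ord_recl /= => pr.
have := @primeP _ pr => -[_ /(_ (p ord0))]; rewrite dvdn_mulr // => /(_ isT).
have r0 : (0 < \prod_(i < k) p (lift ord0 (lift ord0 i)))%N.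
  by apply: prodn_gt0 => i; exact: prime_gt0.
have a1 := prime_gt1 p0; have b1 := prime_gt1 p1.
case/orP=> /eqP E; first by rewrite E in a1.
have : (p ord0 * 1 < p ord0 * (p (lift ord0 ord0) * \prod_(i < k) p (lift ord0 (lift ord0 i))))%N.
  by rewrite ltn_pmul2l ?(ltnW a1) // (leq_trans b1) // leq_pmulr.
by rewrite -E ?muln1 ltnn.
Qed.
End prime_products.

(** * Products of primes with prescribed logarithms *)

Section bertrand.
Variable R : realType.

Lemma bertrand_real : exists2 Y : R, 2 <= Y &
  forall y, Y <= y -> exists2 p : nat, prime p & y / 2 < p%:R <= y.
Proof.
exists (2 * (64 ^ 2)%N%:R + 2); first by rewrite lerDr mulr_ge0.
move=> y Yy; have y0 : 0 <= y / 2 by rewrite divr_ge0 //; apply: le_trans Yy; rewrite addr_ge0 // mulr_ge0.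
pose n := Num.trunc (y / 2); have /andP[n1 n2] := truncn_itv y0; rewrite -/n in n1 n2.
have n_large : (64 ^ 2 <= 2 * n)%N.
  have : (64 ^ 2 <= n)%N by rewrite /n truncn_ge_nat // ler_pdivlMr //; move: Yy; move: (64 ^ 2)%N => a; lra.
  by move=> h; rewrite (leq_trans h) // leq_pmull.
have [p pp /andP[np pn]] := bertrand_large n_large; exists p => //; apply/andP; split.
  by apply: (lt_le_trans n2); rewrite ler_nat.
apply: (@le_trans _ _ (2 * n)%N%:R); first by rewrite ler_nat.
by rewrite natrM; lra.
Qed.

(** The construction aims at the centre c of the cell: each prime but the last is taken within a
    factor 2 below x^(c_i), and the last so that the product falls in (x/2, x]. The logarithms move
    by at most ln 2, which is negligible against half a cell side times ln x. The primes are
    increasing because the whole cell lies in the ordered simplex. *)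
Lemma prime_product_in_cell (Y nu x : R) (d m : nat) (I : {ffun 'I_d.+1 -> 'I_m}) :
  (forall y, Y <= y -> exists2 p : nat, prime p & y / 2 < p%:R <= y) ->
  (0 < m)%N -> 0 < nu -> Y <= expR (nu * ln x) -> 4 * m%:R + 1 <= ln x -> 0 < x ->
  (forall u : d.+1.-tuple R, cell I u -> ordered_simplex nu (@simplex_point R d.+2 u)) ->
  exists p : 'I_d.+2 -> nat, exists u : d.+1.-tuple R,
    [/\ forall i, prime (p i), forall i j : 'I_d.+2, (i <= j)%N -> (p i <= p j)%N,
        dyadic x (\prod_(i < d.+2) p i)%N, cell I u &
        @simplex_point R d.+2 u =
          \row_i (ln (p i)%:R / ln (\prod_(j < d.+2) p j)%N%:R)].
Proof.
move=> HY m0 nu0 Yx Lm x0 Isimp; set L := ln x in Yx Lm.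
have mR : 1 <= m%:R :> R by rewrite ler1n.
have L0 : 5 <= L by lra.
have xE : x = expR L by rewrite lnK.
have ln2a := ln2_le1 R; have ln2b : 0 <= ln 2 :> R by rewrite ln_ge0 // ler1n.
pose c (i : 'I_d.+1) : R := ((I i)%:R + 2^-1) / m%:R.
pose cu : d.+1.-tuple R := [tuple c i | i < d.+1].
have cuI : cell I cu.
  apply/cellP => i; rewrite tnth_mktuple /c -[(I i).+1%:R]natr1; apply/andP; split.
    by rewrite ler_pM2r ?invr_gt0 ?ltr0n //; lra.
  by rewrite ltr_pM2r ?invr_gt0 ?ltr0n //; lra.
have cS := Isimp _ cuI; have c_coord i := simplex_coord nu0 i cS.
case: cS => c_sum c_nu _.
have c_wi i : c i = @simplex_point R d.+2 cu 0 (widen_ord (leqnSn d.+1) i).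
  by rewrite simplex_point_wi tnth_mktuple.
have c_ge i : nu <= c i by rewrite c_wi.
have c_le i : c i <= 1 by rewrite c_wi; have /andP[] := c_coord (widen_ord (leqnSn d.+1) i).
have c_last : nu <= 1 - \sum_(i < d.+1) c i.
  by have := c_nu ord_max; rewrite simplex_point_last; under eq_bigr do rewrite tnth_mktuple.
have exq i : exists q : nat, prime q /\ expR (c i * L) / 2 < q%:R <= expR (c i * L).
  have [|q pq qP] := HY (expR (c i * L)); last by exists q.
  by apply: (le_trans Yx); rewrite ler_expR ler_wpM2r //; lra.
have [q qP] := choice exq.
have lnq i : c i * L - ln 2 <= ln (q i)%:R <= c i * L.
  have [pq /andP[q1 q2]] := qP i; have q0 : 0 < (q i)%:R :> R by rewrite ltr0n prime_gt0.
  rewrite -(ler_expR (ln _)) lnK ?posrE // q2 andbT -ler_expR lnK ?posrE //.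
  by rewrite expRB lnK ?posrE // ltW.
pose Q := (\prod_(i < d.+1) q i)%N.
have Q0 : (0 < Q)%N by apply: prodn_cond_gt0 => i _; have [/prime_gt0] := qP i.
have lnQ : ln Q%:R = \sum_(i < d.+1) ln (q i)%:R :> R.
  rewrite /Q -(big_map q xpredT id) -(big_map q xpredT (fun n => ln n%:R)).
  by apply: ln_prod_nat; apply/allP => _ /mapP[i _ ->]; have [/prime_gt0] := qP i.
have QL : ln Q%:R <= (\sum_(i < d.+1) c i) * L.
  by rewrite lnQ mulr_suml; apply: ler_sum => i _; have /andP[] := lnq i.
have QR : 0 < Q%:R :> R by rewrite ltr0n.
(* Room for the last prime: x / Q is at least x^(1 - sum of c), hence at least x^nu >= Y. *)
have [|r pr /andP[r1 r2]] := HY (x / Q%:R).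
  apply: (le_trans Yx); rewrite -[x / _]lnK ?posrE ?divr_gt0 // ler_expR ln_div ?posrE // -/L.
  have : nu * L <= (1 - \sum_(i < d.+1) c i) * L by apply: ler_wpM2r => //; lra.
  by rewrite mulrBl mul1r; lra.
pose p (i : 'I_d.+2) := if unlift ord_max i is Some j then q j else r.
have p_wi i : p (widen_ord (leqnSn d.+1) i) = q i.
  have -> : widen_ord (leqnSn d.+1) i = lift ord_max i.
    by apply: val_inj; rewrite /= /bump leqNgt ltn_ord.
  by rewrite /p liftK.
have p_max : p ord_max = r by rewrite /p unlift_none.
have pp i : prime (p i) by rewrite /p; case: unliftP => [j _|_] //; have [] := qP j.
set n := (\prod_(i < d.+2) p i)%N.
have nE : n = (Q * r)%N.
  by rewrite /n big_ord_recr /= p_max; congr (_ * _)%N; apply: eq_bigr => i _; rewrite p_wi.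
have nx : dyadic x n.
  rewrite /dyadic nE natrM; apply/andP; split.
    by rewrite [Q%:R * _]mulrC -ltr_pdivrMr // mulrAC.
  by rewrite mulrC -ler_pdivlMr.
have /andP[n1 n2] := nx.
have n0 : 0 < n%:R :> R by apply: le_lt_trans n1; rewrite divr_ge0 // ltW.
have nL : L - ln 2 <= ln n%:R <= L.
  apply/andP; split; rewrite -ler_expR lnK ?posrE // ?expRB ?lnK ?posrE // -?xE //.
  exact: ltW.
have ln0 : 0 < ln n%:R :> R by case/andP: nL; lra.
have lnn : ln n%:R = \sum_(i < d.+2) ln (p i)%:R :> R.
  rewrite /n -(big_map p xpredT id) -(big_map p xpredT (fun n => ln n%:R)).
  by apply: ln_prod_nat; apply/allP => _ /mapP[i _ ->]; exact: prime_gt0.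
pose u : d.+1.-tuple R := [tuple ln (q i)%:R / ln n%:R | i < d.+1].
have uE : @simplex_point R d.+2 u = \row_i (ln (p i)%:R / ln n%:R).
  apply: eq_simplex_point.
  - exact: sum_simplex_point.
  - under eq_bigr do rewrite mxE.
    by rewrite -mulr_suml -lnn mulfV // gt_eqF.
  by move=> i; rewrite simplex_point_wi mxE p_wi tnth_mktuple.
have uI : cell I u.
  apply/cellP => i; rewrite tnth_mktuple.
  have /andP[l1 l2] := lnq i; have /andP[nl1 nl2] := nL; have := c_le i; have := c_ge i.
  have m2 : 0 < (2 * m%:R)^-1 :> R by rewrite invr_gt0; lra.
  (* With M = 1/(2m) half the side, the bound 4m+1 <= L gives M L >= 2 + M. This exceeds both ln 2
     and (c_i + M) ln 2, the shifts caused by ln q_i and by ln n. *)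
  have mm : (2 * m%:R)^-1 * (4 * m%:R + 1) = 2 + (2 * m%:R)^-1 :> R by field; lra.
  have mL : 2 + (2 * m%:R)^-1 <= (2 * m%:R)^-1 * L by rewrite -mm ler_pM2l.
  have m2le : (2 * m%:R)^-1 <= 1 :> R by rewrite invf_le1; lra.
  have -> : (I i)%:R / m%:R = c i - (2 * m%:R)^-1 by rewrite /c; field; lra.
  have -> : (I i).+1%:R / m%:R = c i + (2 * m%:R)^-1 by rewrite /c -[(I i).+1%:R]natr1; field; lra.
  move: (c i) ((2 * m%:R)^-1) l1 l2 m2 mL m2le => C M l1 l2 M0 ML M1 C0 C1.
  rewrite ler_pdivlMr // ltr_pdivrMr //; apply/andP; split; nra.
exists p, u; split=> // i j ij; have [_ _ us] := Isimp _ uI; have := us i j ij.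
rewrite uE !mxE ler_pM2r ?invr_gt0 // ler_ln ?posrE ?ltr0n ?prime_gt0 //.
by rewrite ler_nat.
Qed.
End bertrand.

(** * Pairs with a = b satisfying all conditions *)

Section equal_pair.
Variable R : realType.
Implicit Types (P : triple R) (x B rho varpi : R) (b : nat -> R).

Lemma type_I_zero P B x (w : nat -> R) : 0 <= x -> (forall n, w n = 0) -> type_I P B x w.
Proof.
move=> x0 w0; rewrite /type_I big1 ?divr_ge0 ?powR_ge0 // => m _.
rewrite /max_interval_sum (_ : [set _ | _ in _] = [set 0]) ?sup1 ?mulr0 //.
apply/seteqP; split=> [_ [I _ <-]|_ ->] /=; last exists `]-oo, +oo[ => //;
  by rewrite big1 ?normr0.
Qed.

Lemma type_II_zero P B x (w : nat -> R) : 0 <= x -> (forall n, w n = 0) -> type_II P B x w.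
Proof.
move=> x0 w0 xi kappa _ _; rewrite big1.
  by rewrite normr0 lecR divr_ge0 // powR_ge0.
by move=> m _; rewrite big1 // => n _; rewrite w0 rmorph0 mulr0.
Qed.

Lemma cond_w_zero P varpi x (w : nat -> R) : 0 <= x -> (forall n, w n = 0) -> cond_w P varpi x w.
Proof.
move=> x0 w0; split; last by move=> n _; rewrite w0 oppr_le0 powR_ge0.
by rewrite big1 ?mulr_ge0 ?powR_ge0 // => n _; rewrite w0 normr0 mul0r.
Qed.

Lemma coagulations_R_sum P (h : nat) (v : 'rV[R]_h) : coagulations_R P v -> \sum_i v 0 i = 1.
Proof.
move=> [k [u [[_ <- _] [A [_ A1 ->]]]]].
under eq_bigr do rewrite mxE big_mkcond /=.
rewrite exchange_big /=; apply: eq_bigr => i _.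
have [j [ij juniq]] := A1 i; rewrite (bigD1 j) //= ij big1 ?addr0 // => j' j'j.
by case: ifP => // /juniq e; rewrite e eqxx in j'j.
Qed.

Section model.
Variables (x nu : R) (m kmax p0 : nat).
Hypotheses (x0 : 0 < x) (nu0 : 0 < nu).
Hypotheses (pp0 : prime p0) (p0x : dyadic x p0).
Local Notation index d := {ffun 'I_d.+1 -> 'I_m}.

Definition inner_cell (d : nat) (I : index d) : bool :=
  `[< forall u : d.+1.-tuple R, cell I u -> ordered_simplex nu (@simplex_point R d.+2 u) >].

Variables (p : forall d, index d -> 'I_d.+2 -> nat) (tag : forall d, index d -> d.+1.-tuple R).
Hypothesis pP : forall d (I : index d), inner_cell I ->
  [/\ forall i, prime (p I i), forall i j : 'I_d.+2, (i <= j)%N -> (p I i <= p I j)%N,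
      dyadic x (\prod_(i < d.+2) p I i)%N, cell I (tag I) &
      @simplex_point R d.+2 (tag I) =
        \row_i (ln (p I i)%:R / ln (\prod_(j < d.+2) p I j)%N%:R)].

Definition cell_weight (d : nat) (I : index d) : R :=
  m%:R ^- d.+1 * (\prod_i @simplex_point R d.+2 (tag I) 0 i)^-1.

(** The factor x makes the single prime p0 carry a sum over primes equal to x, so that the masses on
    the products are Riemann weights relative to that sum. *)
Definition model (n : nat) : R :=
  x * ((n == p0)%:R + \sum_(d < kmax) \sum_(I : index d | inner_cell I)
    (n == \prod_(i < d.+2) p I i)%N%:R * cell_weight I).

Lemma cell_weight_ge0 (d : nat) (I : index d) : inner_cell I -> 0 <= cell_weight I.
Proof.
move=> tI; have [_ _ _ cI _] := pP tI; have us := asboolP _ tI _ cI.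
rewrite mulr_ge0 // invr_ge0 ?exprn_ge0 //.
by apply: prodr_ge0 => i _; have /andP[] := simplex_coord nu0 i us.
Qed.

Lemma model_ge0 n : 0 <= model n.
Proof.
rewrite mulr_ge0 ?(ltW x0) // addr_ge0 // sumr_ge0 // => d _; rewrite sumr_ge0 // => I tI.
by rewrite mulr_ge0 // cell_weight_ge0.
Qed.

Lemma model_supported : supported x model.
Proof.
move=> n nx; rewrite /model; case: eqP => [np|_]; first by rewrite np p0x in nx.
rewrite add0r big1 ?mulr0 // => d _; rewrite big1 // => I tI.
case: eqP => [nE|_]; last by rewrite mul0r.
by have [_ _ dI _ _] := pP tI; rewrite nE dI in nx.
Qed.

Lemma model_prime (q : nat) : prime q -> model q = x * (q == p0)%:R.
Proof.
move=> pq; rewrite /model [X in _ + X]big1 ?addr0 // => d _; rewrite big1 // => I tI.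
case: eqP => [qE|_]; last by rewrite mul0r.
by have [pI _ _ _ _] := pP tI; rewrite qE prime_prodF in pq.
Qed.

Lemma prime_sum_model : prime_sum x model = x.
Proof.
rewrite /prime_sum big_mkcond (bigD1_seq p0) ?iota_uniq //=.
  rewrite pp0 model_prime // eqxx mulr1 big1 ?addr0 // => q qp.
  by case: ifP => // pq; rewrite model_prime // (negPf qp) mulr0.
rewrite mem_index_iota prime_gt0 //= ltnS truncn_ge_nat ?(ltW x0) //.
by case/andP: p0x.
Qed.

(** By unique factorization, products of another length match no tuple of d+2 primes, and each
    product of this length matches exactly one ordered tuple, whose logarithmic vector is the tagged
    point. *)
Lemma prime_tuple_sum_model (d : nat) (f : 'rV[R]_d.+2 -> R) : (d < kmax)%N ->
  prime_tuple_sum x model f =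
  x * \sum_(I : index d | inner_cell I) cell_weight I * f (@simplex_point R d.+2 (tag I)).
Proof.
move=> dk; rewrite /prime_tuple_sum.
set N := Num.trunc x.
pose good (q : {ffun 'I_d.+2 -> 'I_N.+1}) := [forall i, prime (q i)] &&
  [forall i : 'I_d.+2, forall j : 'I_d.+2, (i <= j)%N ==> (q i <= q j)%N].
have goodP q : good q -> (forall i, prime (q i)) /\
    (forall i j : 'I_d.+2, (i <= j)%N -> (q i <= q j)%N).
  move=> /andP[/forallP pq /forallP qm]; split=> // i j ij.
  by have /forallP/(_ j)/implyP/(_ ij) := qm i.
pose pt (q : {ffun 'I_d.+2 -> 'I_N.+1}) : 'rV[R]_d.+2 :=
  \row_i (ln (q i)%:R / ln (\prod_(j < d.+2) q j)%N%:R).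
transitivity (\sum_(q | good q) x * \sum_(e < kmax) \sum_(I : index e | inner_cell I)
    (\prod_(i < d.+2) q i == \prod_(i < e.+2) p I i)%N%:R * cell_weight I * f (pt q)).
  apply: eq_bigr => q /goodP[pq qm] /=; rewrite -/(pt q) /model -mulrA; congr (_ * _).
  case: eqP => [E|_].
    by move: pp0; rewrite -E prime_prodF.
  rewrite add0r mulr_suml; apply: eq_bigr => e _; rewrite mulr_suml; apply: eq_bigr => I _ //.
rewrite -mulr_sumr; congr (_ * _).
rewrite exchange_big /= (bigD1 (Ordinal dk)) //= [X in _ + X]big1 ?addr0; last first.
  move=> e ed; rewrite big1 // => q /goodP[pq qm]; rewrite big1 // => I tI.
  case: eqP => [E|_]; last by rewrite !mul0r.
  have [pI mI _ _ _] := pP tI.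
  have /(congr1 size) := prime_functions_eq pq pI qm mI E.
  rewrite size_map size_enum_ord size_map size_enum_ord => -[de].
  by case/negP: ed; apply/eqP/val_inj; rewrite /= de.
rewrite exchange_big /=; apply: eq_bigr => I tI.
have [pI mI dI cI uE] := pP tI.
have pN i : (p I i < N.+1)%N.
  rewrite ltnS truncn_ge_nat ?(ltW x0) //; have /andP[_] := dI; apply: le_trans.
  rewrite ler_nat (bigD1 i) //= leq_pmulr //.
  by apply: prodn_cond_gt0 => j _; exact: prime_gt0.
pose q0 : {ffun 'I_d.+2 -> 'I_N.+1} := [ffun i => Ordinal (pN i)].
have q0E i : q0 i = p I i :> nat by rewrite ffunE.
have prodq0 : (\prod_(i < d.+2) q0 i = \prod_(i < d.+2) p I i)%N.
  by apply: eq_bigr => i _; rewrite q0E.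
rewrite (bigD1 q0) /=; last first.
  apply/andP; split; first by apply/forallP => i; rewrite q0E.
  by apply/forallP => i; apply/forallP => j; apply/implyP => ij; rewrite !q0E mI.
rewrite prodq0 eqxx mul1r big1 ?addr0; last first.
  move=> q /andP[/goodP[pq qm] qq0]; case: eqP => [E|_]; last by rewrite !mul0r.
  case/negP: qq0; apply/eqP/ffunP => i; apply: val_inj; rewrite /= q0E.
  have := prime_functions_eq pq pI qm mI E.
  move/(congr1 (fun s => nth 0%N s i)).
  by rewrite (nth_map i) ?size_enum_ord // nth_ord_enum (nth_map i) ?size_enum_ord // nth_ord_enum.
congr (_ * f _); rewrite uE; apply/rowP => i; rewrite !mxE prodq0 q0E //.
Qed.
End model.

(** The grid size m depends only on B and nu: it makes the Riemann errors at most 1/B for the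
    finitely many dimensions k <= 1/nu at once. Then x is taken large in terms of m. *)
Lemma exists_equal_pair P B rho : 0 < nu P -> 0 < B -> 1 <= rho ->
  \forall x \near +oo%R, exists b,
    [/\ cond_BD rho x b b, forall varpi, 1 < varpi -> Psi P B varpi x (b, b)
      & 0 < prime_sum x b].
Proof.
move=> nu0 B0 rho1; have [Y Y2 HY] := bertrand_real R.
pose kmax := (Num.trunc (nu P)^-1).+1.
pose C (d : nat) : R := 4 * (d.+2%:R * d.+1%:R * (nu P ^- d.+2 * nu P ^- d.+2)) +
  4 * nu P ^- d.+2 * (2 ^+ d.+1 * 3 ^+ d).
have C0 d : 0 <= C d.
  have n0 : 0 <= nu P ^- d.+2 by rewrite invr_ge0 exprn_ge0 // ltW.
  by rewrite /C addr_ge0 // !mulr_ge0 // exprn_ge0.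
pose m := (Num.trunc (B * \sum_(d < kmax) C d)).+1.
have m0 : (0 < m)%N by [].
have mR : 0 < m%:R :> R by rewrite ltr0n.
have Cm d : (d < kmax)%N -> C d / m%:R <= B^-1.
  move=> dk; rewrite ler_pdivrMr // mulrC ler_pdivlMr // mulrC.
  apply: le_trans (ltW (truncnS_gt _)); rewrite ler_pM2l //.
  by rewrite (bigD1 (Ordinal dk)) //= lerDl sumr_ge0.
near=> x.
have x0 : 0 < x by near: x; apply: nbhs_pinfty_gt; rewrite num_real.
have xe (r : R) : expR r <= x -> r <= ln x.
  by move=> h; rewrite -ler_expR lnK // posrE.
have Lm : 4 * m%:R + 1 <= ln x.
  by apply: xe; near: x; apply: nbhs_pinfty_ge; rewrite num_real.
have Yx : Y <= expR (nu P * ln x).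
  have Y0 : 0 < Y by apply: lt_le_trans Y2.
  rewrite -[Y]lnK ?posrE // ler_expR mulrC -ler_pdivrMr //.
  by apply: xe; near: x; apply: nbhs_pinfty_ge; rewrite num_real.
have L1 : 1 <= ln x by apply: le_trans Lm; rewrite lerDr mulr_ge0.
have xY : Y <= x by near: x; apply: nbhs_pinfty_ge; rewrite num_real.
have [p0 pp0 p0x] := HY x xY.
(* Arbitrary values on the cells that are not inner make the choice of primes total. *)
have H d (I : {ffun 'I_d.+1 -> 'I_m}) : exists pu : ('I_d.+2 -> nat) * d.+1.-tuple R,
    inner_cell (nu P) I ->
    [/\ forall i, prime (pu.1 i), forall i j : 'I_d.+2, (i <= j)%N -> (pu.1 i <= pu.1 j)%N,
      dyadic x (\prod_(i < d.+2) pu.1 i)%N, cell I pu.2 &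
      @simplex_point R d.+2 pu.2 =
        \row_i (ln (pu.1 i)%:R / ln (\prod_(j < d.+2) pu.1 j)%N%:R)].
  have [/asboolP tI|_] := boolP (inner_cell (nu P) I); last first.
    by exists (fun=> 0%N, [tuple 0 | _ < d.+1]).
  have [p [u pu]] := prime_product_in_cell HY m0 nu0 Yx Lm x0 tI.
  by exists (p, u).
pose p d I := (sval (cid (H d I))).1; pose tag d I := (sval (cid (H d I))).2.
have pP d (I : {ffun 'I_d.+1 -> 'I_m}) (tI : inner_cell (nu P) I) := svalP (cid (H d I)) tI.
have sumE := prime_sum_model kmax x0 pp0 p0x pP.
exists (model x (nu P) kmax p0 p tag); split; last by rewrite sumE.
- split; last first.
    rewrite sumE ler_pdivrMr; last by rewrite mulr_gt0 //; lra.
    rewrite ler_peMr ?(ltW x0) //; have : 1 * 1 <= rho * ln x by apply: ler_pM.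
    by rewrite mulr1.
  by move=> n _; rewrite subrr normr0 powR_ge0.
move=> varpi varpi1; rewrite /Psi /=; split.
- by split=> n; exact: (model_ge0 kmax p0 x0 nu0 pP).
- by split; exact: (model_supported kmax p0x pP).
- split.
    rewrite /cond_b1 sumE ler_pdivrMr; last by apply: powR_gt0; lra.
    by rewrite ler_peMr ?(ltW x0) //; apply: (le_trans L1); apply: le1r_powR => //; lra.
  case=> [|[|d]] T f k2; [by exfalso; move: k2|by exfalso; move: k2|].
  move=> kn cT Tsub f1 flip.
  have dk : (d < kmax)%N.
    by rewrite /kmax ltnS truncn_ge_nat ?invr_ge0 ?(ltW nu0) // (le_trans _ kn) // ler_nat; exact: leqW (leqnSn d).
  have Tord : T `<=` @ordered_simplex R d (nu P).
    by move=> u /Tsub[cu nuu mu]; split=> //; exact: coagulations_R_sum cu.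
  have := @riemann_sum_approx R d m (nu P) m0 nu0 (@inner_cell (nu P) m d) (tag d)
    (fun I tI => let: And5 _ _ _ h _ := pP d I tI in h)
    (fun I h => asboolT h) T f cT Tord f1 flip.
  set Int := hyperplane_integral T _; set S := \sum_(I | _) _ => hS.
  exists (S - Int); first by rewrite distrC; apply: (le_trans hS); exact: Cm.
  rewrite (prime_tuple_sum_model x0 pp0 pP _ dk) sumE addrC subrK.
  by congr (_ * _); apply: eq_bigr => I _.
have x0' := ltW x0; split.
- by apply: type_I_zero => // n; rewrite subrr.
- by apply: type_II_zero => // n; rewrite subrr.
- by apply: cond_w_zero => // n; rewrite subrr.
Unshelve. all: by end_near.
Qed.
End equal_pair.

(** * The constants *)

Section constants.
Variable R : realType.
Implicit Types (rho nu eps e x : R).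

(** The first summand serves eps < 1/20. The second comes from the trivial bound for eps >= 1/20,
    its 20 from 1 <= 20 eps. Both carry rho, as (BD) bounds x / ln x by rho times the sum of b over
    primes. *)
Definition loss rho : R :=
  10 ^+ 5 * 8 `^ rho * rho + 20 * (4 * 2 `^ rho * rho).

Lemma loss_ge0 rho : 1 <= rho -> 0 <= loss rho.
Proof.
move=> rho1; have rho0 : 0 <= rho by lra.
by rewrite addr_ge0 // !mulr_ge0 // ?powR_ge0 // exprn_ge0.
Qed.

Lemma prime_sum_close rho nu eps e : 1 <= rho -> 3^-1 <= nu < 2^-1 ->
  0 <= eps <= 10^-1 -> 0 < e ->
  let P := Triple (2^-1 - eps) eps (nu - 2 * eps) in
  forall varpi, \forall x \near +oo%R, forall a b : nat -> R,
    cond_BD rho x a b -> Psi P 3 varpi x (a, b) ->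
    `|prime_sum x a - prime_sum x b| <= (loss rho * eps + e) * prime_sum x b.
Proof.
move=> rho1 nuP epsP e0 P varpi; have rho0 : 0 < rho by lra.
have [eps0 eps1] := andP epsP.
pose c1 := 10 ^+ 5 * 8 `^ rho : R; pose c2 := 4 * 2 `^ rho : R.
have c1_gt0 : 0 < c1 by rewrite mulr_gt0 ?exprn_gt0 ?powR_gt0.
have c2_ge0 : 0 <= c2 by rewrite mulr_ge0 ?powR_ge0.
have lossE : loss rho = c1 * rho + 20 * (c2 * rho) by [].
(* For eps < 1/20 this exceeds eps, stays at most 1/20, and exceeds eps by so little that c1 rho
   (eta - eps) <= e. *)
pose eta := eps + Num.min (e / (c1 * rho)) (20^-1 - eps).
near=> x.
have xeta : expR (6 / eta) <= x by near: x; apply: nbhs_pinfty_ge; rewrite num_real.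
move=> a b [wtau bBD] [[a0 b0] [as_ bs] _ [tI tII _]].
have x4 : 4 <= x by near: x; apply: nbhs_pinfty_ge; rewrite num_real.
have x0 : 0 < x by lra.
pose w n := a n - b n.
have ws : supported x w by move=> n nx; rewrite /w as_ // bs // subrr.
have -> : prime_sum x a - prime_sum x b = prime_sum x w by rewrite /prime_sum -sumrB.
have lx : 0 < ln x by rewrite ln_gt0 //; lra.
set S := prime_sum x b in bBD *.
have xS : x / ln x <= rho * S.
  by move: bBD; rewrite invfM mulrCA -ler_pdivlMl ?invr_gt0 // invrK.
have S0 : 0 <= S by apply: le_trans bBD; rewrite divr_ge0 ?mulr_ge0 ?ltW.
have [eps20|eps20] := ltP eps 20^-1.
  have cr : 0 < c1 * rho by rewrite mulr_gt0.
  have eta_gt : eps < eta.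
    by rewrite /eta ltrDl lt_min divr_gt0 //= subr_gt0.
  have eta_le : eta <= 20^-1 by rewrite /eta -lerBrDl ge_min lexx orbT.
  have eta_e : eta <= eps + e / (c1 * rho) by rewrite /eta lerD2l ge_min lexx.
  have Lx : 6 / eta <= ln x.
    by rewrite -ler_expR lnK ?posrE.
  have eta0 : 0 < eta by lra.
  have epseta : 0 <= eps <= eta by rewrite eps0 ltW.
  have eta20 : 0 < eta <= 20^-1 by rewrite eta0.
  have := prime_sum_bound rho1 nuP epseta eta20 Lx x0 ws wtau tI tII.
  move=> /le_trans; apply; rewrite -/c1.
  apply: (@le_trans _ _ (c1 * eta * (rho * S))).
    by rewrite ler_wpM2l // mulr_ge0 ?ltW.
  rewrite mulrA; apply: ler_wpM2r => //.
  have : c1 * rho * eta <= c1 * rho * (eps + e / (c1 * rho)) by rewrite ler_pM2l.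
  have -> : c1 * rho * (eps + e / (c1 * rho)) = c1 * rho * eps + e.
    by field; rewrite !gt_eqF.
  have : 0 <= c2 * rho * eps by rewrite !mulr_ge0 // ltW.
  rewrite lossE; nra.
apply: (le_trans (prime_sum_trivial_bound rho1 x4 ws wtau)); rewrite -/c2.
apply: (@le_trans _ _ (c2 * (rho * S))); first by rewrite ler_wpM2l.
rewrite mulrA; apply: ler_wpM2r => //.
have : c2 * rho * 1 <= c2 * rho * (20 * eps).
  by apply: ler_wpM2l; [rewrite mulr_ge0 // ltW|lra].
have : 0 <= c1 * rho * eps by rewrite !mulr_ge0 // ltW.
rewrite lossE; nra.
Unshelve. all: by end_near.
Qed.

Lemma ereal_dist1_le (c : \bar R) (k : R) :
  ((1 - k)%:E <= c)%E -> (c <= (1 + k)%:E)%E -> (`|c - 1| <= k%:E)%E.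
Proof.
case: c => [r| |] //=; rewrite !lee_fin => h1 h2.
by rewrite ler_norml; apply/andP; split; lra.
Qed.
End constants.

Theorem theorem2p5 (R : realType) (rho : R) (hrho : 1 <= rho) :
  exists K : R, forall nu eps : R,
    3^-1 <= nu < 2^-1 -> 0 <= eps <= 10^-1 ->
    let Peps := Triple (2^-1 - eps) eps (nu - 2 * eps) in
    (`|C_bd_minus Peps rho - 1| <= (K * eps)%:E)%E /\
    (`|C_bd_plus Peps rho - 1| <= (K * eps)%:E)%E.
Proof.
exists (loss rho) => nu eps nuP epsP P.
have Keps : 0 <= loss rho * eps by case/andP: epsP => ? _; rewrite mulr_ge0 ?loss_ge0.
have nu0 : 0 < Defs.nu P by rewrite /=; lra.
(* A pair with a = b and positive sum over primes forbids C > 1 as a lower constant and C < 1 as an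
   upper one. *)
have equal_pair B (H : R -> Prop) : 0 < B -> (\forall x \near +oo%R, H x) ->
    exists x b, [/\ H x, cond_BD rho x b b, Psi P B 2 x (b, b) & 0 < prime_sum x b].
  move=> B0 Hx; have [x [Hx' [b [b1 b2 b3]]]] := filter_ex (filterI Hx (exists_equal_pair nu0 B0 hrho)).
  by exists x, b; split=> //; apply: b2; rewrite ltr1n.
split; apply: ereal_dist1_le.
(* Every e > 0 gives an admissible constant with B = 3; the slack e disappears in the supremum. *)
- apply/lee_addgt0Pr => e e0.
  have -> : (1 - loss rho * eps)%:E = ((1 - loss rho * eps - e)%:E + e%:E)%E.
    by rewrite -EFinD subrK.
  rewrite leeD2r //; apply: ereal_sup_ubound; exists (1 - loss rho * eps - e) => // varpi _.
  exists 3; first by [].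
  have := @prime_sum_close R rho nu eps e hrho nuP epsP e0 varpi.
  apply: filterS => x H a b BD ab; have := H a b BD ab.
  by rewrite ler_norml => /andP[+ _]; rewrite -/P; lra.
- apply: (@le_trans _ _ 1%E); last by rewrite lee_fin lerDl.
  apply: ge_ereal_sup => _ [C CP <-]; rewrite lee_fin.
  have [B B0 HB] := CP 2 (ltr1n R 2).
  have [x [b [Hx b1 b2 b3]]] := equal_pair B _ B0 HB.
  by have := Hx b b b1 b2; rewrite ger_pMl.
- apply: (@le_trans _ _ 1%E); first by rewrite lee_fin gerDl oppr_le0.
  apply: le_ereal_inf_tmp => _ [C CP <-]; rewrite lee_fin.
  have [B B0 HB] := CP 2 (ltr1n R 2).
  have [x [b [Hx b1 b2 b3]]] := equal_pair B _ B0 HB.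
  by have := Hx b b b1 b2; rewrite ler_pMl.
- apply/lee_addgt0Pr => e e0; rewrite -EFinD.
  apply: ereal_inf_lbound; exists (1 + loss rho * eps + e) => // varpi _.
  exists 3; first by [].
  have := @prime_sum_close R rho nu eps e hrho nuP epsP e0 varpi.
  apply: filterS => x H a b BD ab; have := H a b BD ab.
  by rewrite ler_norml => /andP[_]; rewrite -/P; lra.
Qed.
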